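(* Let $N \ge 2$ and let $P \colon C \to P(C)$ be a map on the non-negative orthant $C \subset \mathbb{R}^N$ satisfying the standing assumptions (H1), (H2), (H3$'$), (H4$'$), (H5), (H6) listed in the context, and let $S$ be the carrying simplex for $P$. Assume that $S$ is convex, i.e. that the global attractor $\Gamma = \{\alpha x : \alpha \in [0,1],\ x \in S\}$ is a convex set. Then for each ergodic invariant measure $\mu$ supported on $\partial S = S \cap \partial C$ the principal Lyapunov exponent of $\mu$ is smaller than all external Lyapunov exponents of $\mu$.
   Context: Notation. $C = \{x \in \mathbb{R}^N : x_i \ge 0 \text{ for all } i\}$, $V = \mathbb{R}^N$ (as a vector space), $K = \{v \in V : v_i \ge 0 \text{ for all } i\}$, $C^\circ = \{x \in C: x_i>0 \text{ for all } i\}$, $\partial C = C \setminus C^\circ$. For $I \subset \{1,\dots,N\}$: $C_I = \{x \in C : x_j = 0 \text{ for } j \notin I\}$, $\dot C_I = \{x \in C_I : x_i > 0 \text{ for } i \in I\}$, $\partial C_I = C_I \setminus \dot C_I$, $V_I = \{v \in V : v_j = 0 \text{ for } j \notin I\}$, $K_I = K \cap V_I$, $\dot K_I = \{v \in K_I : v_i>0 \text{ for } i \in I\}$. For $x,y \in C_I$ (or in $V_I$): $x \le_I y$ if $x_i \le y_i$ for all $i \in I$; $x <_I y$ if $x \le_I y$ and $x \ne y$; $x \ll_I y$ if $x_i < y_i$ for all $i \in I$; the subscript is dropped when $I = \{1,\dots,N\}$. A set $A \subset C$ is invariant if $P(A)=A$. A map $P = (P_1,\dots,P_N)\colon C \to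 P(C) \subset \mathbb{R}^N$ is a $C^k$ diffeomorphism onto its image if it is the restriction to $C$ of a $C^k$ diffeomorphism $\tilde P \colon U \to \tilde P(U)$, with $U \supset C$ open in $\mathbb{R}^N$. Standing assumptions on $P$: (H1) $P$ is a $C^2$ diffeomorphism onto its image $P(C)$. (H2) For each nonempty $I \subset \{1,\dots,N\}$, each of the sets $A = C_I, \dot C_I, \partial C_I$ satisfies $P(A) \subset A$ and $P^{-1}(A) \subset A$. (H3$'$) For each nonempty $I \subset \{1,\dots,N\}$ and $x \in \dot C_I$, the $I \times I$ matrix $D(P|_{C_I})(x)^{-1} = (DP(x)^{-1})_I = (DP^{-1}(Px))_I$ has all entries positive. Moreover, for any non-zero $v \in K_{\{1,\dots,N\}\setminus I}$ there exists $j \in I$ such that $(DP(x)^{-1}v)_j > 0$. (H4$'$) For each $i \in \{1,\dots,N\}$, $P|_{C_{\{i\}}}$ has a unique fixed point $u_i$ with positive $i$-th coordinate, and $0 < (d/dx_i)(P|_{C_{\{i\}}})(u_i) < 1$. Moreover, $\frac{\partial P_i}{\partial x_j}(u_i) < 0$ for $j \ne i$. (H5) If $I$ is nonempty and $x \in \dot C_I$ is a nontrivial (nonzero) $p$-periodic point of $P$, then $\mu_{I,p}(x) < 1$, where $\mu_{I,p}(x)$ is the (necessarily real) eigenvalue of $D(P|_{C_I})^p(x)$ with the smallest modulus. (H6) For each nonempty $I \subset \{1,\dots,N\}$ and $x,y \in \dot C_I$, if $0 \ll_I Px \ll_I Py$, then $\frac{P_i x}{P_i y} \ge \frac{x_i}{y_i}$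 for all $i \in I$. Let $\triangle = \{x \in C : \sum_i x_i = 1\}$ and let $R\colon C\setminus\{0\} \to \triangle$, $R(x) = x/\sum_i x_i$, be the radial projection. It is known that under these assumptions there is a compact invariant set $S \subset C$, the carrying simplex for $P$, such that: (i) $R|_S \colon S \to \triangle$ is a homeomorphism; (ii) no two points of $S$ are related by $\ll$, and for each nonempty $I$ no two points of $S \cap \dot C_I$ are related by $<_I$; (iii) for each $x \in C \setminus \{0\}$ the $\omega$-limit set of $x$ is contained in $S$; (iv) the global attractor $\Gamma$ of $P$ (the compact invariant set $\Gamma\subset C$ such that for every bounded $B \subset C$ and every $\epsilon>0$, $P^n(B)$ lies in the $\epsilon$-neighbourhood of $\Gamma$ for all sufficiently large $n$) equals $\{\alpha x : \alpha \in [0,1],\ x \in S\}$. Put $S_I = S \cap C_I$, $\dot S_I = S \cap \dot C_I$, $\partial S_I = S \cap \partial C_I$. Lyapunov exponents. Let $DP(x,v) = (Px, DP(x)v)$ be the linear skew-product on $C \times V$; its restriction to $\Gamma \times V$ is a bundle automorphism. Let $\mu$ be an ergodic $P$-invariant Borel probability measure supported on $\partial S$, and let $I(\mu) \subset \{1,\dots,N\}$ be the (unique, by ergodicity) set with $\mu(\dot S_{I(\mu)}) = 1$. The bundles $S_{I(\mu)} \times V_{I(\mu)}$ and $S_{I(\mu)} \times V_{I(\mu)\cup\{j\}}$ ($j \notin I(\mu)$) are invariant under $DP$. The Lyapunov exponents (with respect to $\mu$, in the sense of Oseledets' theorem) of $DP$ restricted to $S_{I(\mu)} \times V_{I(\mu)}$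 are the internal Lyapunov exponents of $\mu$; the smallest internal one is the principal Lyapunov exponent. For $j \in \{1,\dots,N\}\setminus I(\mu)$, the $j$-th external Lyapunov exponent is the one additional (counting multiplicities) Lyapunov exponent of $DP$ restricted to $S_{I(\mu)} \times V_{I(\mu)\cup\{j\}}$, compared with those of the restriction to $S_{I(\mu)} \times V_{I(\mu)}$. *)

(* Defs.v *)
From HB Require Import structures.
From mathcomp Require Import all_boot all_order all_algebra.
From mathcomp Require Import all_classical all_reals all_analysis.
From mathcomp Require Import complex.

Set Implicit Arguments.
Unset Strict Implicit.
Unset Printing Implicit Defensive.

Import Order.TTheory GRing.Theory Num.Theory.
Import numFieldNormedType.Exports.

Local Open Scope classical_set_scope.
Local Open Scope ring_scope.

(* Points and vectors of R^N are row vectors: the derivative DP(x) acts on v as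
   v *m jacobian P x, so that jacobian P x j i is the partial derivative of P_i
   with respect to x_j, and invmx (jacobian P x) j i is the (i, j) entry of the
   usual matrix DP(x)^-1. *)

Section Orthant.
Context {R : realType} {N : nat}.
Local Notation V := 'rV[R]_N.
Implicit Types (I : {set 'I_N}) (x y : V).

Definition orthant : set V := [set x | forall i, 0 <= x 0 i].
Definition orthant_int : set V := [set x | forall i, 0 < x 0 i].
Definition orthant_bd : set V := orthant `\` orthant_int.

Definition coord_space I : set V := [set v | forall j, j \notin I -> v 0 j = 0].
Definition face I : set V := orthant `&` coord_space I.
Definition face_int I : set V :=
  face I `&` [set x | forall i, i \in I -> 0 < x 0 i].
Definition face_bd I : set V := face I `\` face_int I.

Definition le_on I x y := forall i, i \in I -> x 0 i <= y 0 i.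
Definition lt_on I x y := le_on I x y /\ x <> y.
Definition ll_on I x y := forall i, i \in I -> x 0 i < y 0 i.

Definition simplex : set V := orthant `&` [set x | \sum_i x 0 i = 1].
Definition radial x : V := (\sum_i x 0 i)^-1 *: x.

End Orthant.

Section Smoothness.
Context {R : realType} {N : nat}.
Local Notation V := 'rV[R]_N.

(* Used for U open only. *)
Fixpoint Ck_on (k : nat) (U : set V) (f : V -> V) : Prop :=
  match k with
  | 0%N => forall x, U x -> {for x, continuous f}
  | k'.+1 => (forall x, U x -> differentiable f x) /\
             (forall v : V, Ck_on k' U (fun x => 'D_v f x))
  end.

Definition Ck_diffeo_on (k : nat) (U : set V) (f : V -> V) : Prop :=
  [/\ open U, open (f @` U), Ck_on k U f &
   exists2 g : V -> V, Ck_on k (f @` U) g & forall x, U x -> g (f x) = x].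

End Smoothness.

Section Assumptions.
Context {R : realType} {N : nat}.
Local Notation V := 'rV[R]_N.
Implicit Types (P : V -> V) (I : {set 'I_N}) (x y v : V).

(* A map on the orthant is given here by a map P on the whole of R^N, of which
   only the germ along the orthant matters: P is chosen to coincide on U with
   the diffeomorphic extension, so that jacobian P x is DP(x) at boundary
   points of the orthant too.  The values of P outside U are irrelevant. *)
Definition C2_diffeo_on_orthant P : Prop :=
  exists2 U : set V, orthant `<=` U & Ck_diffeo_on 2 U P.

(* [orthant `&` P @^-1` A] is the preimage of A by the restriction of P to the
   orthant. *)
Definition faces_invariant P : Prop :=
  forall I, (0 < #|I|)%N ->
  forall A : set V, A = face I \/ A = face_int I \/ A = face_bd I ->
  P @` A `<=` A /\ orthant `&` P @^-1` A `<=` A.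

Definition inverse_derivative_positive P : Prop :=
  forall I, (0 < #|I|)%N -> forall x, face_int I x ->
  (forall i j, i \in I -> j \in I -> 0 < invmx (jacobian P x) j i) /\
  (forall v, face (~: I)%SET v -> v != 0 ->
     exists2 j, j \in I & 0 < (v *m invmx (jacobian P x)) 0 j).

Definition axial_fixed_points P : Prop :=
  forall i : 'I_N, exists u : V,
  [/\ [/\ face [set i]%SET u, 0 < u 0 i & P u = u],
      (forall w : V, face [set i]%SET w -> 0 < w 0 i -> P w = w -> w = u),
      0 < jacobian P u i i < 1 &
      forall j, j != i -> jacobian P u j i < 0].

Definition smallest_modulus_eigenvalue (m : nat) (A : 'M[R]_m) (l : R) : Prop :=
  let Ac := map_mx (real_complex R) A in
  eigenvalue Ac (real_complex R l) /\
  forall z : R[i], eigenvalue Ac z -> `|real_complex R l| <= `|z|.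

(* The matrix of the derivative at x of the restriction of P to face I. *)
Definition jacobian_on P I x : 'M[R]_#|I| :=
  mxsub (@enum_val _ (mem I)) (@enum_val _ (mem I)) (jacobian P x).

Definition periodic_eigenvalue_lt1 P : Prop :=
  forall I, (0 < #|I|)%N -> forall (p : nat) x,
  (0 < p)%N -> face_int I x -> iter p P x = x ->
  exists2 l : R,
    smallest_modulus_eigenvalue (jacobian_on (iter p P) I x) l & l < 1.

Definition ratio_monotone P : Prop :=
  forall I, (0 < #|I|)%N -> forall x y, face_int I x -> face_int I y ->
  ll_on I 0 (P x) -> ll_on I (P x) (P y) ->
  forall i, i \in I -> x 0 i / y 0 i <= P x 0 i / P y 0 i.

End Assumptions.

Section CarryingSimplex.
Context {R : realType} {N : nat}.
Local Notation V := 'rV[R]_N.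
Implicit Types (P : V -> V) (S G : set V).

Definition omega_limit P (x : V) : set V := cluster ((fun n => iter n P x) @ \oo).

Definition global_attractor P G : Prop :=
  [/\ compact G, G `<=` orthant, P @` G = G &
   forall B : set V, bounded_set B -> B `<=` orthant ->
   forall e : R, 0 < e ->
   \forall n \near \oo, forall x, B x ->
     exists2 y, G y & `|iter n P x - y| < e].

Definition cone_over S : set V :=
  [set z | exists a x, [/\ 0 <= a <= 1, S x & z = a *: x]].

(* As radial 0 = 0 lies outside the simplex, 0 is not in S by [set_bij]. *)
Definition carrying_simplex P S : Prop :=
  [/\ [/\ compact S, S `<=` orthant & P @` S = S],
   [/\ set_bij S simplex radial, {within S, continuous radial} &
     exists2 g : V -> V, {within simplex, continuous g} &
       forall x, S x -> g (radial x) = x],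
   (forall x y, S x -> S y -> ~ ll_on [set: 'I_N]%SET x y) /\
   (forall I : {set 'I_N}, (0 < #|I|)%N -> forall x y,
     (S `&` face_int I) x -> (S `&` face_int I) y -> ~ lt_on I x y),
   forall x, orthant x -> x != 0 -> omega_limit P x `<=` S &
   global_attractor P (cone_over S)].

End CarryingSimplex.

Definition borel_rV (R : realType) (N : nat) :=
  g_sigma_algebraType (@open 'rV[R]_N).

Section Lyapunov.
Context {R : realType} {N : nat}.
Local Notation V := 'rV[R]_N.
Implicit Types (P : V -> V) (S : set V) (mu : probability (borel_rV R N) R).
Implicit Types (I J : {set 'I_N}).

(* The dynamical system is the restriction of P to the orthant, so preimages
   are taken within the orthant. *)
Definition invariant_measure P mu : Prop :=
  forall A : set (borel_rV R N), measurable A ->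
  mu (orthant `&` P @^-1` A) = mu A.

Definition ergodic_measure P mu : Prop :=
  invariant_measure P mu /\
  forall A : set (borel_rV R N), measurable A ->
  orthant `&` P @^-1` A = A -> mu A = 0%E \/ mu A = 1%E.

Definition skew P (xv : V * V) : V * V :=
  (P xv.1, xv.2 *m jacobian P xv.1).

(* The inverse of [skew P] as an automorphism of the bundle S x V, for an
   invariant set S on which P is injective. *)
Definition skew_inv P S (xv : V * V) : V * V :=
  let y := 'pinv_(fun=> 0) S P xv.1 in (y, xv.2 *m invmx (jacobian P y)).

Definition has_exponent P S (x v : V) (l : R) : Prop :=
  ((fun n : nat => ln `|(iter n (skew P) (x, v)).2| / n%:R) @ \oo --> l) /\
  ((fun n : nat => ln `|(iter n (skew_inv P S) (x, v)).2| / n%:R) @ \oo --> - l).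

(* [s] lists, with multiplicities, the Lyapunov exponents of the derivative
   cocycle on the bundle with fibre [coord_space J]: almost every fibre has an
   Oseledets splitting whose summand of exponent [l] has dimension the
   multiplicity of [l] in [s].  Measurability and invariance of the splitting
   are automatic, since the limits determine the summands. *)
Definition lyapunov_exponents P S mu J (s : seq R) : Prop :=
  {ae mu, forall x : V, exists E : R -> {vspace V},
    [/\ directv (\sum_(l <- undup s) E l)%VS,
        (forall v, v \in (\sum_(l <- undup s) E l)%VS <-> coord_space J v),
        (forall l, l \in s -> \dim (E l) = count_mem l s) &
        forall l v, l \in s -> v \in E l -> v != 0 -> has_exponent P S x v l]}.

(* In the next two definitions, I is the set I(mu). *)
Definition principal_exponent P S mu I (l : R) : Prop :=
  exists2 s, lyapunov_exponents P S mu I s &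
    l \in s /\ forall l', l' \in s -> l <= l'.

Definition external_exponent P S mu I (j : 'I_N) (l : R) : Prop :=
  exists2 s, lyapunov_exponents P S mu I s &
    lyapunov_exponents P S mu (j |: I)%SET (l :: s).

End Lyapunov.

(* Main.v *)
(** A point x of S in the face of I carries a nonnegative functional L supporting
    the convex set Gamma at x, because no point of Gamma dominates x strictly.
    Since Gamma is invariant, pushing L forward by DP^-1 along the orbit gives
    supporting functionals L_n at P^n x.  On one hand, Gamma contains a point of
    the j-th axis, so the j-th entry of L_n is at most a constant times its mass
    on I, which is controlled by the backward growth of the vector 1_I, i.e. by
    exp(-n lp).  On the other hand, that entry grows at least like the product of
    the (j,j) entries of DP^-1, i.e. like exp(-n l), and moreover gains a fixed
    factor 1 + gain at each visit to a set where the second half of (H3')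
    transfers mass from I to j.  By Markov's inequality for the number of visits,
    such gains occur with positive frequency for suitable x, whence lp < l.  No
    ergodic theorem is needed: the backward estimate holds at almost every end
    point P^n x, and is transported to x by the invariance of mu. *)
Require Import Defs.
From HB Require Import structures.
From mathcomp Require Import all_boot all_order all_algebra.
From mathcomp Require Import all_classical all_reals all_analysis.
From mathcomp Require Import measurable_realfun ring lra zify.

Set Implicit Arguments.
Unset Strict Implicit.
Unset Printing Implicit Defensive.

Import Order.TTheory GRing.Theory Num.Theory.
Import numFieldNormedType.Exports.

Local Open Scope classical_set_scope.
Local Open Scope ring_scope.

(** * Finite sums of real functions and the sup norm on row vectors *)

Lemma cvg_sumr {R : realType} {T : Type} (F : set_system T)
    (I : finType) (p : pred I) (f : I -> T -> R) (l : I -> R) :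
  Filter F -> (forall i, p i -> f i x @[x --> F] --> l i) ->
  (\sum_(i | p i) f i x) @[x --> F] --> \sum_(i | p i) l i.
Proof. by move=> FF h; apply: cvg_big => //; exact: add_continuous. Qed.

Lemma continuous_sumr {R : realType} {T : topologicalType} (I : finType)
    (p : pred I) (f : I -> T -> R) (x : T) :
  (forall i, p i -> {for x, continuous (f i)}) ->
  {for x, continuous (fun z => \sum_(i | p i) f i z)}.
Proof. exact: (@cvg_sumr _ _ (nbhs x)). Qed.

Lemma coord_le_norm {R : realType} {N : nat} (x : 'rV[R]_N) i :
  `|x 0 i| <= `|x|.
Proof.
rewrite [leRHS]/Num.norm /= mx_normrE; apply/bigmax_geP; right => /=.
by exists (0, i).
Qed.

Lemma norm_le_sum {R : realType} {N : nat} (x : 'rV[R]_N) :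
  `|x| <= \sum_i `|x 0 i|.
Proof.
rewrite [leLHS]/Num.norm /= mx_normrE; apply/bigmax_leP; split.
  exact: sumr_ge0.
move=> [k i] _ /=; rewrite (ord1 k) (bigD1 i) //= lerDl.
exact: sumr_ge0.
Qed.

(** * Supporting functionals of convex sets *)

Section NormalVectors.
Context {R : realType} {N : nat}.
Local Notation V := 'rV[R]_N.
Implicit Types (G : set V) (x y z : V) (L : 'cV[R]_N).

Definition pairing y L : R := \sum_i y 0 i * L i 0.

Lemma pairingE y L : pairing y L = (y *m L) 0 0.
Proof. by rewrite mxE. Qed.

Definition convex_subset G := forall y z (t : R), 0 <= t <= 1 -> G y -> G z ->
  G (y + t *: (z - y)).

Definition normal_at G x L :=
  [/\ forall i, 0 <= L i 0, L != 0 &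
      forall y, G y -> pairing y L <= pairing x L].

(** Quadratic upper bound for the squared positive part, whose derivative, twice the positive part,
    is 2-Lipschitz. *)
Lemma posB_sqr_le (a s : R) :
  Num.max 0 (a - s) ^+ 2 <= Num.max 0 a ^+ 2 - 2 * Num.max 0 a * s + s ^+ 2.
Proof.
by have [a0|a0] := lerP 0 a; have [h|h] := lerP 0 (a - s); nra.
Qed.

(** First-order optimality condition: for small [t] the linear term dominates. The contradiction is
    taken at [t = a / b], or at [t = 1] if [a / b] leaves the interval. *)
Lemma le0_of_quadratic (a b : R) :
  (forall t, 0 < t <= 1 -> 0 <= - (2 * t * a) + t ^+ 2 * b) -> a <= 0.
Proof.
move=> h; rewrite leNgt; apply/negP => a0.
have b0 : 0 < b by have := h 1; nra.
have [ab|ab] := lerP a b.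
  have t0 : 0 < a / b by rewrite divr_gt0.
  have t1 : a / b <= 1 by rewrite ler_pdivrMr // mul1r.
  have := h (a / b); rewrite t0 t1 => /(_ isT).
  have -> : - (2 * (a / b) * a) + (a / b) ^+ 2 * b = - (a / b * a).
    by field; rewrite gt_eqF.
  by rewrite oppr_ge0 leNgt mulr_gt0.
by have := h 1; lra.
Qed.

Lemma pairing_continuous L : continuous (pairing^~ L).
Proof.
move=> y; apply: continuous_sumr => i _.
apply: continuousM; [exact: coord_continuous|exact: cst_continuous].
Qed.

(* The proof minimises over [y] in [G] the squared distance from [x + e] to the
   points below [y]; the gradient at the minimum is an approximate normal. *)
Lemma approx_normal G x (e : R) : compact G -> convex_subset G -> G x ->
  (forall y, G y -> exists i, y 0 i <= x 0 i) -> 0 < e ->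
  exists L, [/\ forall i, 0 <= L i 0, \sum_i L i 0 = 1 &
     forall y, G y -> pairing y L <= pairing x L + e].
Proof.
move=> Gc Gconv Gx Gno e0.
pose h y : R :=
  \sum_i Num.max 0 (x 0 i + e - y 0 i) * Num.max 0 (x 0 i + e - y 0 i).
have hc : continuous h.
  move=> y; apply: continuous_sumr => i _.
  have c1 : {for y, continuous (fun z : V => Num.max 0 (x 0 i + e - z 0 i))}.
    apply: (@continuous_max R _ (fun=> 0) (fun z : V => x 0 i + e - z 0 i)).
      exact: cst_continuous.
    apply: continuousB; first exact: cst_continuous.
    exact: coord_continuous.
  exact: continuousM.
have [y /set_mem Gy ymin] :
    exists2 y, y \in G & forall t, t \in G -> h y <= h t.
  apply: compact_EVT_min => //; first by exists x.
  exact: continuous_subspaceT.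
(* Up to the factor -2 this is the gradient of [h] at its minimiser [y]. It is nonzero because some
   coordinate of [y] does not exceed that of [x]; divided by its sum [s], it becomes the approximate
   normal. *)
pose l i := Num.max 0 (x 0 i + e - y 0 i).
have l0 i : 0 <= l i by rewrite /l le_max lexx.
have sl0 : 0 < \sum_i l i.
  have [i yi] := Gno _ Gy; rewrite (bigD1 i) //=.
  apply: ltr_wpDr; first by apply: sumr_ge0.
  by rewrite /l lt_max; apply/orP; right; lra.
set s := \sum_i l i in sl0.
exists (\col_i (l i / s)); split.
- by move=> i; rewrite mxE divr_ge0 // ltW.
- under eq_bigr do rewrite mxE.
  by rewrite -mulr_suml divff // gt_eqF.
move=> z Gz.
have pE w : pairing w (\col_i (l i / s)) = (\sum_i w 0 i * l i) / s.
  by rewrite /pairing mulr_suml; apply: eq_bigr => i _; rewrite mxE mulrA.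
(* First-order optimality of [y] along the segment towards [z], which stays in [G] by convexity. *)
have h1 : \sum_i l i * (z 0 i - y 0 i) <= 0.
  apply: (@le0_of_quadratic _ (\sum_i (z 0 i - y 0 i) ^+ 2)) => t /andP[t0 t1].
  have Gt : G (y + t *: (z - y)) by apply: Gconv => //; rewrite t1 ltW.
  have := ymin _ (mem_set Gt); rewrite -subr_ge0 => /le_trans; apply.
  rewrite /h -sumrB !mulr_sumr -sumrN -big_split /=; apply: ler_sum => i _.
  rewrite !mxE -!expr2.
  have := posB_sqr_le (x 0 i + e - y 0 i) (t * (z 0 i - y 0 i)).
  rewrite -/(l i).
  have -> : x 0 i + e - (y 0 i + t * (z 0 i - y 0 i)) =
    x 0 i + e - y 0 i - t * (z 0 i - y 0 i) by ring.
  lra.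
(* Wherever [l i] is nonzero, [y] exceeds [x] by less than [e]. *)
have h2 : \sum_i l i * (y 0 i - x 0 i) <= e * s.
  rewrite /s mulr_sumr; apply: ler_sum => i _.
  rewrite /l; have [u|u] := lerP 0 (x 0 i + e - y 0 i); last by lra.
  rewrite mulrC; apply: ler_wpM2r => //; lra.
rewrite !pE ler_pdivrMr // mulrDl divfK ?gt_eqF // -lerBlDl -sumrB.
suff -> : \sum_i (z 0 i * l i - x 0 i * l i) =
  \sum_i l i * (z 0 i - y 0 i) + \sum_i l i * (y 0 i - x 0 i) by lra.
by rewrite -big_split /=; apply: eq_bigr => i _; ring.
Qed.

Lemma simplex_compact : compact [set x : V | (forall i, 0 <= x 0 i) /\
   \sum_i x 0 i = 1].
Proof.
apply: bounded_closed_compact.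
  exists N%:R; split; first exact: num_real.
  move=> M NM x [x0 x1] /=; apply/ltW/(le_lt_trans _ NM).
  apply: le_trans (norm_le_sum x) _.
  have -> : N%:R = \sum_(i < N) 1 :> R by rewrite sumr_const card_ord.
  apply: ler_sum => i _; rewrite ger0_norm // -x1 (bigD1 i) //= lerDl.
  exact: sumr_ge0.
apply: closedI.
  have -> : (fun x : V => forall i, 0 <= x 0 i) =
      \bigcap_i [set x : V | 0 <= x 0 i].
    by apply/seteqP; split => [x h i _|x h i]; [exact: h|exact: (h i)].
  apply: closed_bigI => i _.
  apply: (@preimage_closed _ _ (fun x : V => x 0 i) [set r : R | 0 <= r]).
    by move=> x _; exact: coord_continuous.
  exact: closed_ge.
apply: (@preimage_closed _ _ (fun x : V => \sum_i x 0 i) [set r : R | r = 1]).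
  by move=> x _; apply: continuous_sumr => i _; exact: coord_continuous.
exact: closed_eq.
Qed.

(** The approximate normals with error [1 / (n + 1)] lie in the compact standard simplex, and any
    cluster point is an exact normal; total mass 1 survives in the limit and keeps it nonzero. *)
Lemma normal_exists G x : compact G -> convex_subset G -> G x ->
  (forall y, G y -> exists i, y 0 i <= x 0 i) -> exists L, normal_at G x L.
Proof.
move=> Gc Gconv Gx Gno.
have /choice[l lP] : forall n : nat, exists l : V,
    [/\ forall i, 0 <= l 0 i, \sum_i l 0 i = 1 &
     forall y, G y -> pairing y l^T <= pairing x l^T + n.+1%:R^-1].
  move=> n; have e0 : 0 < n.+1%:R^-1 :> R by rewrite invr_gt0.
  have [L [L0 L1 LG]] := approx_normal Gc Gconv Gx Gno e0.
  exists L^T; split; rewrite ?trmxK //; first by move=> i; rewrite mxE.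
  by under eq_bigr do rewrite mxE.
have [|p [[p0 p1] pc]] := @simplex_compact (l @ \oo) _.
  by exists 0%N => // n _; have [] := lP n.
exists p^T; split.
- by move=> i; rewrite mxE.
- apply/eqP => /(congr1 trmx); rewrite trmxK trmx0 => pE.
  move: p1; rewrite pE; under eq_bigr do rewrite mxE.
  by rewrite big1_eq => /esym/eqP; rewrite oner_eq0.
move=> y Gy; apply/ler_addgt0Pr => e e0.
pose A (d : R) := [set q : V | pairing y q^T - pairing x q^T <= d].
have Acl d : closed (A d).
  apply: (@preimage_closed _ _ (fun q : V => pairing y q^T - pairing x q^T)
    [set r : R | r <= d]); last exact: closed_le.
  have pairc z : continuous (fun q : V => pairing z q^T).
    move=> q; apply: continuous_sumr => i _.
    apply: continuousM; first exact: cst_continuous.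
    have -> : (fun q : V => q^T i 0) = (fun q : V => q 0 i).
      by apply/funext => r; rewrite mxE.
    exact: coord_continuous.
  move=> q _; move: (pairc y q) (pairc x q).
  exact: (@continuousB _ _ _ (fun q : V => pairing y q^T)
    (fun q : V => pairing x q^T)).
suff : A e p by rewrite /A /= lerBlDl addrC.
have -> : A e = closure (A e) by exact/closure_id.
move=> U Up.
have h : \forall n \near \oo, A e (l n); last exact: pc.
near=> n; have [_ _ /(_ _ Gy)] := lP n.
rewrite /A /= -lerBlDl => /le_trans; apply.
apply/ltW; near: n; exact: (near_infty_natSinv_lt (PosNum e0)).
Unshelve. all: end_near. Qed.

End NormalVectors.

(** * Exponential growth and Oseledets splittings *)

Section GrowthRates.
Context {R : realType}.
Implicit Types (u v : nat -> R) (a b : R).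

Definition growth_le u a := forall e, 0 < e ->
  \forall n \near \oo, u n <= expR (n%:R * (a + e)).

Definition exact_growth u a := (fun n : nat => ln (u n) / n%:R) @ \oo --> a.

Lemma growth_le_mono u v a b : a <= b -> (forall n, u n <= v n) ->
  growth_le v a -> growth_le u b.
Proof.
move=> ab uv va e e0; apply: filterS (va _ e0) => n /(le_trans (uv n)).
by move=> /le_trans; apply; rewrite ler_expR ler_wpM2l // lerD2r.
Qed.

Lemma growth_leM u a (C : R) : (forall n, 0 <= u n) ->
  growth_le u a -> growth_le (fun n => C * u n) a.
Proof.
move=> u0 ua e e0; have e20 : 0 < e / 2 by lra.
near=> n.
have h1 : u n <= expR (n%:R * (a + e / 2)) by near: n; exact: ua.
have h2 : C <= expR (n%:R * (e / 2)).
  apply: le_trans (expR_ge1Dx _).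
  rewrite -lerBlDl -ler_pdivrMr //; near: n; exact: nbhs_infty_ger.
have -> : n%:R * (a + e) = n%:R * (e / 2) + n%:R * (a + e / 2) by field.
rewrite expRD; apply: le_trans (_ : expR (n%:R * (e / 2)) * u n <= _).
  exact: ler_wpM2r.
by apply: ler_wpM2l => //; exact: expR_ge0.
Unshelve. all: end_near. Qed.

Lemma growth_leD u v a : growth_le u a -> growth_le v a ->
  growth_le (fun n => u n + v n) a.
Proof.
move=> ua va; pose w n := Num.max 0 (Num.max (u n) (v n)).
have w0 n : 0 <= w n by rewrite /w le_max lexx.
have wa : growth_le w a.
  move=> e e0; near=> n; rewrite !ge_max expR_ge0 /=.
  apply/andP; split; near: n.
    exact: ua.
  exact: va.
apply: (@growth_le_mono _ (fun n => 2 * w n) a a (lexx a)) => [n|];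
  last exact: growth_leM.
rewrite mulr_natl mulr2n; apply: lerD; rewrite /w !le_max lexx ?orbT //.
Unshelve. all: end_near. Qed.

Lemma growth_le_sum (T : eqType) (r : seq T) (f : T -> nat -> R) a :
  (forall i, i \in r -> growth_le (f i) a) ->
  growth_le (fun n => \sum_(i <- r) f i n) a.
Proof.
elim: r => [_|i r IH h].
  by move=> e e0; near=> n; rewrite big_nil expR_ge0.
have -> : (fun n => \sum_(j <- i :: r) f j n) =
  (fun n => f i n + \sum_(j <- r) f j n) by apply/funext => n; rewrite big_cons.
apply: growth_leD; first by apply: h; rewrite mem_head.
by apply: IH => k kr; apply: h; rewrite inE kr orbT.
Unshelve. all: end_near. Qed.

Lemma exact_growth_le u a : (forall n, 0 <= u n) -> exact_growth u a ->
  growth_le u a.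
Proof.
move=> u0 ua e e0; near=> n.
have n0 : 0 < n%:R :> R by rewrite ltr0n; near: n; exact: nbhs_infty_gt.
(* Since [ln 0] is 0, the limit says nothing about vanishing terms, which are treated apart. *)
have [->|un] := eqVneq (u n) 0; first exact: expR_ge0.
have unp : 0 < u n by rewrite lt_neqAle eq_sym un u0.
rewrite -[leLHS](lnK unp) ler_expR.
rewrite mulrC -ler_pdivrMr //; near: n.
have /cvgrPdist_le /(_ _ e0) := ua; apply: filterS => n.
by rewrite distrC ler_distl => /andP[_].
Unshelve. all: end_near. Qed.

Lemma exact_growth_le_le u a b : (forall n, 0 < u n) -> exact_growth u a ->
  growth_le u b -> a <= b.
Proof.
move=> u0 ua ub; apply/ler_addgt0Pr => e e0.
have e20 : 0 < e / 2 by lra.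
near \oo => n.
have n0 : 0 < n%:R :> R by rewrite ltr0n; near: n; exact: nbhs_infty_gt.
have h1 : a - e / 2 <= ln (u n) / n%:R.
  near: n; have /cvgrPdist_le /(_ _ e20) := ua; apply: filterS => n.
  by rewrite distrC ler_distl => /andP[].
have h2 : ln (u n) / n%:R <= b + e / 2.
  rewrite ler_pdivrMr // mulrC -ler_expR lnK ?posrE //.
  by near: n; exact: ub.
lra.
Unshelve. all: end_near. Qed.

End GrowthRates.

Lemma seq_max_exists {R : realType} (s : seq R) : s != [::] ->
  exists2 m, m \in s & forall x, x \in s -> x <= m.
Proof.
elim: s => // a [_ _|b s IH _].
  by exists a => [|x]; rewrite ?mem_head // inE => /eqP ->.
have [//|m ms mx] := IH.
have [am|ma] := lerP a m.
  by exists m => [|x]; rewrite inE ?ms ?orbT // => /predU1P[->//|/mx].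
exists a => [|x]; first exact: mem_head.
by rewrite inE => /predU1P[->//|/mx /le_trans -> //]; exact: ltW.
Qed.

Section VectorGrowth.
Context {R : realType} {N : nat}.
Context (K : nat -> 'M[R]_N).
Local Notation nrm v := (fun n : nat => `|v *m K n|).

Lemma growth_le_vsum (r : seq R) (p : pred R) (f : R -> 'rV[R]_N) b :
  (forall i, i \in r -> p i -> growth_le (nrm (f i)) b) ->
  growth_le (nrm (\sum_(i <- r | p i) f i)) b.
Proof.
move=> h.
apply: (@growth_le_mono _ _
  (fun n => \sum_(i <- [seq i <- r | p i]) `|f i *m K n|) b _ (lexx b));
  last first.
  by apply: growth_le_sum => i; rewrite mem_filter => /andP[pi ir]; exact: h.
by move=> n; rewrite mulmx_suml big_filter; exact: ler_norm_sum.
Qed.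

Context (Kinj : forall n (v : 'rV[R]_N), v *m K n = 0 -> v = 0).

(** Each component is indexed by its own growth rate. If some nonzero one were faster than [b], the
    fastest, of rate [m], would equal the whole sum minus the other components, all of which grow at
    rates below [m]. *)
Lemma fast_components_vanish (r : seq R) (f : R -> 'rV[R]_N) b : uniq r ->
  (forall i, i \in r -> f i != 0 -> exact_growth (nrm (f i)) i) ->
  growth_le (nrm (\sum_(i <- r) f i)) b ->
  forall i, i \in r -> b < i -> f i = 0.
Proof.
move=> ru fr wb i ir bi; apply/eqP/negPn/negP => fi0.
pose bad := [seq k <- r | (b < k) && (f k != 0)].
have [|m] := @seq_max_exists _ bad.
  have ibad : i \in bad by rewrite mem_filter bi fi0 ir.
  by apply/eqP => bad0; rewrite bad0 in ibad.
rewrite mem_filter => /andP[/andP[bm fm0] mr] mx.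
have fgt0 k n : f k != 0 -> 0 < `|f k *m K n|.
  by move=> fk; rewrite normr_gt0; apply: contra fk => /eqP /Kinj ->.
have slower : exists2 c, c < m & growth_le (nrm (f m)) c; last first.
  have [c cm gc] := slower.
  have := exact_growth_le_le (fun n => fgt0 m n fm0) (fr _ mr fm0) gc.
  by rewrite leNgt cm.
have others : exists2 c, c < m &
    growth_le (nrm (\sum_(k <- r | k != m) f k)) c.
  (* Induction on sublists of [r] produces a single rate [c] strictly below [m]; for the empty sum
     any such rate will do, here [m - 1]. *)
  have : forall s : seq R, {subset s <= r} -> exists2 c, c < m &
    growth_le (nrm (\sum_(k <- s | k != m) f k)) c.
    elim => [_|k s IH sr].
      exists (m - 1); first by rewrite ltrBlDr ltrDl.
      move=> e e0; near=> n.
      by rewrite big_nil mul0mx normr0; exact: expR_ge0.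
    have [|c cm gc] := IH; first by move=> q qs; apply: sr; rewrite inE qs orbT.
    have kr : k \in r by apply: sr; exact: mem_head.
    rewrite big_cons; have [->|km] := eqVneq k m; first by exists c.
    have [->|fk] := eqVneq (f k) 0; first by rewrite add0r; exists c.
    have klm : k < m.
      rewrite lt_neqAle km /=; have [bk|kb] := ltrP b k; last first.
        exact/(le_trans kb)/ltW.
      by apply: mx; rewrite mem_filter bk fk.
    exists (Num.max k c); first by rewrite gt_max klm.
    apply: (@growth_le_mono _ _ (fun n => `|f k *m K n| +
      `|(\sum_(k <- s | k != m) f k) *m K n|) _ _ (lexx _)).
      by move=> n; rewrite mulmxDl ler_normD.
    apply: growth_leD.
      apply: (growth_le_mono _ (fun n => lexx _)
        (exact_growth_le _ (fr _ kr fk))).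
        by rewrite le_max lexx.
      by [].
    by apply: (growth_le_mono _ (fun n => lexx _) gc); rewrite le_max lexx orbT.
  by apply.
have [c cm gc] := others.
exists (Num.max b c); first by rewrite gt_max bm.
apply: (@growth_le_mono _ _ (fun n => `|(\sum_(i <- r) f i) *m K n| +
      `|(\sum_(k <- r | k != m) f k) *m K n|) _ _ (lexx _)).
  move=> n; rewrite (bigD1_seq m) //= mulmxDl.
  rewrite -[f m *m K n in leLHS](addrK ((\sum_(k <- r | k != m) f k) *m K n)).
  exact: ler_normB.
apply: growth_leD.
  by apply: (growth_le_mono _ (fun n => lexx _) wb); rewrite le_max lexx.
by apply: (growth_le_mono _ (fun n => lexx _) gc); rewrite le_max lexx orbT.
Unshelve. all: end_near. Qed.

End VectorGrowth.

(** * Events of large probability *)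

Section ProbabilityLemmas.
Context {d : measure_display} {T : measurableType d} {R : realType}.
Context (mu : probability T R).

Lemma probability_setC_le (A : set T) (e : R) : measurable A ->
  (mu (~` A) <= e%:E)%E -> ((1 - e)%:E <= mu A)%E.
Proof.
move=> mA; rewrite probability_setC // => h.
have fA : mu A \is a fin_num by exact: fin_num_measure.
move: h; rewrite -(fineK fA) -EFinB !lee_fin; lra.
Qed.

(** The tail intersections [E m] increase to a set of full measure, so the measures of their
    complements tend to 0 by continuity from above; the complement of [A n] lies in that of
    [E n]. *)
Lemma eventually_in_measure (A : nat -> set T) (e : R) :
  (forall n, measurable (A n)) ->
  {ae mu, forall x, \forall n \near \oo, A n x} -> 0 < e ->
  \forall n \near \oo, (mu (~` A n) <= e%:E)%E.
Proof.
move=> mA [Z [mZ Z0 AZ]] e0.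
pose E m := \bigcap_(n in [set n | (m <= n)%N]) A n.
have mE m : measurable (E m) by exact: bigcap_measurableType.
have mU : measurable (\bigcup_m E m) by exact: bigcup_measurable.
have ndE : nondecreasing_seq E.
  move=> m n mn; apply/subsetPset => x Ex k /= nk.
  by apply: Ex => /=; exact: leq_trans nk.
have U1 : mu (~` \bigcup_m E m) = 0%E.
  apply/eqP; rewrite -measure_le0 -Z0; apply: le_measure; rewrite ?inE //.
    exact: measurableC.
have cvg0 : (mu \o (fun m => ~` E m)) @ \oo --> mu (~` \bigcup_m E m).
  rewrite setC_bigcup; apply: nonincreasing_cvg_mu => //.
  - by rewrite (le_lt_trans (probability_le1 _ _)) ?ltry //; exact: measurableC.
  - by move=> m; exact: measurableC.
  - by apply: bigcap_measurableType => // m _; exact: measurableC.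
  - by move=> m n mn; apply/subsetPset/subsetC/subsetPset/ndE.
rewrite U1 in cvg0.
have := cvg0; move/fine_cvgP => [fin] /cvgrPdist_le /(_ _ e0) h.
near=> n.
apply: le_trans (_ : mu (~` E n) <= _)%E.
  apply: le_measure; rewrite ?inE; [exact: measurableC|exact: measurableC|].
  by apply: subsetC => x; apply => /=.
have h1 : `|0 - fine (mu (~` E n))| <= e by near: n; exact: h.
rewrite -[leLHS]fineK ?lee_fin; last by near: n; exact: fin.
by apply: le_trans h1; rewrite sub0r normrN ler_norm.
Unshelve. all: end_near. Qed.

(** Markov's inequality: if every point of [H] lay in more than half of the [B k], integrating the
    count over [H] would give [(n + 1) / 2 * (1 - e) <= n * e], impossible for [e < 1/3]. *)
Lemma exists_rarely_in (H : set T) (B : nat -> set T) (n : nat) (e : R) :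
  measurable H -> (forall k, measurable (B k)) ->
  (mu (~` H) <= e%:E)%E -> (forall k, (mu (B k) <= e%:E)%E) -> e < 3%:R^-1 ->
  exists2 x, H x & (\sum_(k < n) (x \in B k) * 2 <= n)%N.
Proof.
move=> mH mB He Be e3; apply: contrapT => no.
(* Integrality improves a count above [n / 2] to at least [(n + 1) / 2], which keeps the final
   inequality strict even for [n = 0]. *)
have many x : H x -> (n.+1%:R / 2 <= \sum_(k < n) \1_(B k) x :> R).
  move=> Hx; rewrite ler_pdivrMr // leNgt; apply/negP => few; apply: no.
  exists x => //; rewrite -ltnS -(ltr_nat R) -big_distrl natrM natr_sum.
  by under eq_bigr do rewrite -indicE.
have mf k : measurable_fun [set: T] (EFin \o (\1_(B k) : T -> R)).
  exact/measurable_EFinP/measurable_indic.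
have iB k : (\int[mu]_x (\1_(B k) x)%:E = mu (B k))%E.
  by rewrite integral_indic // setIT.
have int_le : ((n.+1%:R / 2)%:E * mu H <= \sum_(k < n) mu (B k))%E.
  rewrite -integral_cst //.
  under [leRHS]eq_bigr do rewrite -iB.
  rewrite -ge0_integral_sum //=; last by move=> k; exact: mf.
  apply: le_trans (_ : \int[mu]_(x in H) (\sum_(k < n) (\1_(B k) x)%:E) <= _)%E.
    apply: ge0_le_integral => //=.
    - by apply: measurable_funTS; apply: emeasurable_sum => k; exact: mf.
    - by move=> x Hx; rewrite sumEFin lee_fin many.
  apply: ge0_subset_integral => //.
    by apply: emeasurable_sum => k; exact: mf.
  by move=> x _; apply: sume_ge0 => k _; rewrite lee_fin.
have sum_le : (\sum_(k < n) mu (B k) <= (n%:R * e)%:E)%E.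
  apply: le_trans (_ : \sum_(k < n) e%:E <= _)%E; first exact: lee_sum.
  by rewrite sumEFin lee_fin sumr_const card_ord mulr_natl.
have e0 : 0 <= e by rewrite -lee_fin; exact: le_trans (Be 0%N).
have := le_trans int_le sum_le; apply/negP; rewrite -ltNge.
apply: lt_le_trans (lee_wpmul2l _ (probability_setC_le mH He)); last first.
  by rewrite lee_fin divr_ge0.
rewrite -EFinM lte_fin -natr1.
have n0 : 0 <= n%:R :> R by [].
nra.
Qed.

End ProbabilityLemmas.

Lemma closed_measurable_rV {R : realType} {N : nat} (A : set 'rV[R]_N) :
  closed A -> measurable (A : set (borel_rV R N)).
Proof.
move=> cA; rewrite -[X in measurable X]setCK.
by apply: measurableC; apply: sub_sigma_algebra; exact: closed_openC.
Qed.

Lemma memv_sum_seqP {F : fieldType} {vT : vectType F} {T : eqType} (r : seq T)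
    (E : T -> {vspace vT}) v : uniq r -> v \in (\sum_(i <- r) E i)%VS ->
  exists2 f : T -> vT, forall i, i \in r -> f i \in E i & v = \sum_(i <- r) f i.
Proof.
elim: r v => [|i r IH] v.
  by rewrite !big_nil memv0 => _ /eqP ->; exists (fun=> 0); rewrite ?big_nil.
rewrite big_cons /= => /andP[ir ur] /memv_addP[u uE [w /(IH _ ur)[f fE ->] ->]].
exists (fun k => if k == i then u else f k).
  move=> k; rewrite inE; case: eqVneq => [->//|_] /=; exact: fE.
rewrite big_cons eqxx; congr (_ + _); apply: eq_big_seq => k kr.
by case: eqVneq kr => // ->; rewrite (negPf ir).
Qed.

Section Splittings.
Context {R : realType} {N : nat}.
Local Notation V := 'rV[R]_N.
Context (K K' : nat -> 'M[R]_N).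
Context (Kinj : forall n (v : V), v *m K n = 0 -> v = 0).
Context (K'inj : forall n (v : V), v *m K' n = 0 -> v = 0).

Definition two_sided_exponent (v : V) (l : R) :=
  exact_growth (fun n => `|v *m K n|) l /\
  exact_growth (fun n => `|v *m K' n|) (- l).

Definition oseledets_splitting (W : set V) (s : seq R) (E : R -> {vspace V}) :=
  [/\ forall v, v \in (\sum_(l <- undup s) E l)%VS <-> W v,
      forall l, l \in s -> \dim (E l) = count_mem l s &
      forall l v, l \in s -> v \in E l -> v != 0 -> two_sided_exponent v l].

(** Backward in time a component of exponent [l] grows at rate [- l], which is at most [- m]. *)
Lemma backward_growth_le W s E w (m : R) : oseledets_splitting W s E ->
  (forall l, l \in s -> m <= l) -> W w ->
  growth_le (fun n => `|w *m K' n|) (- m).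
Proof.
move=> [EW _ Eexp] sm /EW /memv_sum_seqP[|f fE ->]; first exact: undup_uniq.
apply: growth_le_vsum => i ir _.
have is_ : i \in s by rewrite -mem_undup.
have [->|fi0] := eqVneq (f i) 0.
  by move=> e e0; apply: nearW => n; rewrite mul0mx normr0 expR_ge0.
apply: (@growth_le_mono _ _ (fun n => `|f i *m K' n|) (- i)) => //.
  by rewrite lerN2 sm.
apply: exact_growth_le => //; have := Eexp _ _ is_ (fE _ ir) fi0.
by case.
Qed.

(** Forward growth rules out components of exponent above [l], backward growth those below [l], so
    only the summand of exponent [l] can contribute. *)
Lemma two_sided_exponent_mem W s E v l : oseledets_splitting W s E -> W v ->
  two_sided_exponent v l -> if l \in s then v \in E l else v == 0.
Proof.
move=> [EW _ Eexp] /EW /memv_sum_seqP[|f fE vE]; first exact: undup_uniq.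
move=> [vf vb].
have fexp i : i \in undup s -> f i != 0 -> two_sided_exponent (f i) i.
  by move=> ir; apply: (Eexp _ _ _ (fE _ ir)); rewrite -mem_undup.
have hi i : i \in undup s -> l < i -> f i = 0.
  apply: (fast_components_vanish Kinj (undup_uniq s)).
    by move=> k ks fk; have [] := fexp _ ks fk.
  by rewrite -vE; apply: exact_growth_le.
have lo i : i \in undup s -> i < l -> f i = 0.
  move=> ir il.
  (* Reindexing by the opposite exponents turns the backward estimate into an instance of the
     forward one. *)
  pose r' := map -%R (undup s).
  have r'E k : (k \in r') = (- k \in undup s).
    by rewrite -[k in LHS]opprK mem_map //; exact: oppr_inj.
  have := @fast_components_vanish _ _ K' K'inj r' (fun k => f (- k)) (- l)
    _ _ _ (- i).
  rewrite opprK r'E opprK ltrN2; apply => //.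
  - by rewrite map_inj_uniq ?undup_uniq //; exact: oppr_inj.
  - move=> k; rewrite r'E => ks fk; have [_] := fexp _ ks fk.
    by rewrite opprK.
  - rewrite big_map; under eq_bigr do rewrite opprK.
    by rewrite -vE; apply: exact_growth_le.
have f0 i : i \in undup s -> i != l -> f i = 0.
  by move=> ir; rewrite neq_lt => /orP[/lo|/hi]; apply.
have [ls|lns] := boolP (l \in s).
  have lu : l \in undup s by rewrite mem_undup.
  rewrite vE (bigD1_seq l) ?undup_uniq //= big_seq_cond big1 ?addr0 ?fE //.
  by move=> i /andP[]; exact: f0.
rewrite vE big_seq big1 // => i ir; apply: f0 => //.
by apply: contra lns => /eqP <-; rewrite -mem_undup.
Qed.

(* If every vector of exponent [l] for [W'] lay in [W], it would lie in the
   summand [E l], whose dimension is too small by one. *)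
Lemma external_vector W W' s E E' l : oseledets_splitting W s E ->
  oseledets_splitting W' (l :: s) E' ->
  exists v, [/\ W' v, ~ W v & two_sided_exponent v l].
Proof.
move=> splE [EW' dimE' Eexp']; apply: contrapT => no.
have lls : l \in l :: s by exact: mem_head.
have memW v : v \in E' l -> v != 0 -> W v.
  move=> vE v0; apply: contrapT => nW; apply: no; exists v; split => //.
    apply/EW'; rewrite (bigD1_seq l) ?undup_uniq ?mem_undup //=.
    exact: (subvP (addvSl _ _)).
  exact: Eexp'.
have inE' v : v \in E' l -> if l \in s then v \in E l else v == 0.
  move=> vE; have [->|v0] := eqVneq v 0; first by case: ifP; rewrite ?mem0v.
  have := two_sided_exponent_mem splE (memW v vE v0) (Eexp' _ _ lls vE v0).
  by rewrite (negPf v0).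
have := dimE' _ lls; rewrite /= eqxx add1n.
have [ls|lns] := boolP (l \in s).
  have [_ /(_ _ ls) dE _] := splE.
  have /dimvS : (E' l <= E l)%VS by apply/subvP => v /inE'; rewrite ls.
  by rewrite dE => /[swap] ->; rewrite ltnn.
have -> : E' l = 0%VS.
  apply/eqP; rewrite -subv0; apply/subvP => v /inE'.
  by rewrite (negPf lns) memv0.
by rewrite dimv0.
Qed.

End Splittings.

(** * The inverse derivative *)

Lemma near_eq_continuous {T U : topologicalType} (f h : T -> U) x :
  (\forall z \near x, f z = h z) ->
  {for x, continuous f} -> {for x, continuous h}.
Proof.
move=> fh; rewrite /prop_for /continuous_at (nbhs_singleton fh).
exact: cvg_trans (near_eq_cvg fh).
Qed.

Section Derivatives.
Context {R : realType} {N : nat}.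
Local Notation V := 'rV[R]_N.
Implicit Types (f g : V -> V) (a v x : V) (L : 'cV[R]_N).

Lemma jacobian_entry f x k i : differentiable f x ->
  jacobian f x k i = ('D_(delta_mx 0 k) f x) 0 i.
Proof.
by move=> df; rewrite deriveEjacobian // -rowE [RHS]mxE. Qed.

(** The derivative is the limit of right difference quotients, whose pairings with [L] are
    nonpositive. *)
Lemma pairing_derive_le0 f a v L : differentiable f a ->
  (forall t, 0 < t <= 1 -> pairing (f (a + t *: v)) L <= pairing (f a) L) ->
  pairing ('D_v f a) L <= 0.
Proof.
move=> df hf.
have dv : derivable f a v by exact: diff_derivable.
have h0 : (fun h : R => h^-1 *: (f (h *: v + a) - f a)) @ 0^'+ --> 'D_v f a.
  have h00 : (fun h : R => h^-1 *: (f (h *: v + a) - f a)) @ 0^' --> 'D_v f a.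
    exact: dv.
  exact: cvg_dnbhs_at_right.
have h1 : (fun h : R => pairing (h^-1 *: (f (h *: v + a) - f a)) L) @ 0^'+ -->
    pairing ('D_v f a) L.
  exact: (cvg_comp _ (pairing^~ L) h0 (@pairing_continuous _ _ L _)).
apply: (closed_cvg (fun r : R => r <= 0) _ _ _ h1); first exact: closed_le.
near=> h.
have h0' : 0 < h by near: h; exact: nbhs_right_gt.
have h1' : h <= 1 by near: h; exact: nbhs_right_le.
have := hf h; rewrite h0' h1' => /(_ isT).
rewrite addrC /pairing => le.
under eq_bigr do rewrite !mxE -mulrA mulrBl.
rewrite -mulr_sumr sumrB pmulr_rle0 ?invr_gt0 // subr_le0.
exact: le.
Unshelve. all: end_near. Qed.

Lemma jacobian_left_inverse f g x : differentiable f x ->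
  differentiable g (f x) -> (\forall z \near x, g (f z) = z) ->
  jacobian f x *m jacobian g (f x) = 1%:M.
Proof.
move=> df dg gf; apply/row_matrixP => k.
rewrite row_mul -deriveEjacobian // rowE -deriveEjacobian //.
rewrite [in LHS]deriveE // [X in 'd g (f x) X]deriveE //.
rewrite -[LHS]/(('d g (f x) \o 'd f x) _) -diff_comp // -deriveE; last first.
  exact: differentiable_comp.
rewrite (near_eq_derive _ (g := id)) // derive_id.
by rewrite ?rowE ?mulmx1.
Qed.

End Derivatives.

Definition C2_inverse {R : realType} {N : nat} (P g : 'rV[R]_N -> 'rV[R]_N)
    (U : set 'rV[R]_N) :=
  [/\ open U, orthant `<=` U, Ck_on 2 U P, Ck_on 2 (P @` U) g &
     forall x, U x -> g (P x) = x].

(* Locked: unification must not unfold the inverse matrix. *)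
HB.lock Definition invD {R : realType} {N : nat} (P : 'rV[R]_N -> 'rV[R]_N)
  (x : 'rV[R]_N) : 'M[R]_N := invmx (jacobian P x).
Canonical invD_unlockable := Unlockable invD.unlock.

Section InverseDerivative.
Context {R : realType} {N : nat}.
Local Notation V := 'rV[R]_N.
Context (P g : V -> V) (U : set V).
Context (Pg : C2_inverse P g U).
Context (H2 : faces_invariant P) (H3 : inverse_derivative_positive P).
Implicit Types (x v : V) (I : {set 'I_N}).

Let U_open : open U. Proof. by case: Pg => h _ _ _ _; exact: h. Qed.
Let orthU : orthant `<=` U. Proof. by case: Pg => _ h _ _ _; exact: h. Qed.
Let P_C2 : Ck_on 2 U P. Proof. by case: Pg => _ _ h _ _; exact: h. Qed.
Let g_C2 : Ck_on 2 (P @` U) g. Proof. by case: Pg => _ _ _ h _; exact: h. Qed.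
Let gP x : U x -> g (P x) = x. Proof. by case: Pg => _ _ _ _ h; exact: h. Qed.

Local Notation invD := (invD P).

Lemma invD_invmx x : invD x = invmx (jacobian P x).
Proof. by rewrite unlock. Qed.

Lemma P_differentiable x : U x -> differentiable P x.
Proof. by case: P_C2 => + _; exact. Qed.

Lemma P_continuous x : U x -> {for x, continuous P}.
Proof. by move=> /P_differentiable; exact: differentiable_continuous. Qed.

Lemma g_differentiable x : U x -> differentiable g (P x).
Proof. by move=> Ux; case: g_C2 => + _; apply; exists x. Qed.

Lemma jacobianP_mul x : U x -> jacobian P x *m jacobian g (P x) = 1%:M.
Proof.
move=> Ux; apply: jacobian_left_inverse.
- exact: P_differentiable.
- exact: g_differentiable.
- by near=> z; apply: gP; near: z; exact: open_nbhs_nbhs.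
Unshelve. all: end_near. Qed.

Lemma jacobianP_unit x : U x -> jacobian P x \in unitmx.
Proof. by move=> Ux; exact: (mulmx1_unit (jacobianP_mul Ux)).1. Qed.

Lemma invDE x : U x -> invD x = jacobian g (P x).
Proof.
move=> Ux; rewrite invD_invmx -[RHS](mulKmx (jacobianP_unit Ux)).
by rewrite jacobianP_mul // mulmx1.
Qed.

Lemma mul_invD x : U x -> jacobian P x *m invD x = 1%:M.
Proof. by move=> Ux; rewrite invD_invmx mulmxV // jacobianP_unit. Qed.

Lemma invD_entry x k i : U x -> invD x k i = ('D_(delta_mx 0 k) g (P x)) 0 i.
Proof.
by move=> Ux; rewrite invDE // jacobian_entry //; exact: g_differentiable.
Qed.

Lemma invD_continuous k i x : U x -> {for x, continuous (fun z => invD z k i)}.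
Proof.
move=> Ux.
have h : {for x, continuous (fun z => ('D_(delta_mx 0 k) g (P z)) 0 i)}.
  apply: (@continuous_comp _ _ _ P (fun y => ('D_(delta_mx 0 k) g y) 0 i)).
    exact: P_continuous.
  apply: (@continuous_comp _ _ _ (fun y => 'D_(delta_mx 0 k) g y)
    (fun v : V => v 0 i)); last exact: coord_continuous.
  case: g_C2 => _ /(_ (delta_mx 0 k)) [+ _] => /(_ (P x)) dd.
  by apply: differentiable_continuous; apply: dd; exists x.
apply: near_eq_continuous h.
have : nbhs x U by exact: open_nbhs_nbhs.
apply: filterS => z Uz; exact: (esym (invD_entry k i Uz)).
Qed.

(** (H3') for the full index set gives positivity at interior points; a boundary point is the limit
    of the interior points [x + t * (1, ..., 1)], and the entries are continuous. *)
Lemma invD_ge0 x k i : orthant x -> 0 <= invD x k i.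
Proof.
move=> x0; rewrite leNgt; apply/negP => neg.
pose y (t : R) : V := x + t *: const_mx 1.
have yc : y @ 0^'+ --> x.
  have -> : x = x + 0 *: const_mx 1 by rewrite scale0r addr0.
  apply: cvg_at_right_filter; apply: cvgD; first exact: cvg_cst.
  by apply: cvgZl; exact: cvg_id.
have hc := cvg_comp _ _ yc (@invD_continuous k i x (orthU x0)).
have hneg : \forall t \near 0^'+, invD (y t) k i < 0.
  exact: (cvgr_lt _ hc _ neg).
near (0:R)^'+ => t.
have t0 : 0 < t by near: t; exact: nbhs_right_gt.
suff : 0 < invD (y t) k i.
  by rewrite ltNge => /negP; apply; apply: ltW; near: t.
have yt i' : 0 < y t 0 i' by rewrite !mxE mulr1 ltr_wpDl.
have NT : (0 < #|[set: 'I_N]%SET|)%N by apply/card_gt0P; exists k; rewrite inE.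
have [|h _] := @H3 [set: 'I_N]%SET NT (y t); last first.
  by rewrite invD_invmx; apply: h; rewrite inE.
split; [split|by move=> ? _; exact: yt].
- by move=> i'; exact: ltW.
- by move=> j; rewrite inE.
Unshelve. all: end_near. Qed.

Lemma face_image I x : (0 < #|I|)%N -> face I x -> face I (P x).
Proof.
move=> I0 xI; have [+ _] := H2 I0 (A := face I) (or_introl erefl).
by apply; exists x.
Qed.

(** Moving from [x] in direction [k] stays in the invariant face of [I], where the coordinate [i] of
    [P] vanishes identically. *)
Lemma jacobian_face0 I x k i : face I x -> k \in I -> i \notin I ->
  jacobian P x k i = 0.
Proof.
move=> xI kI iI.
have I0 : (0 < #|I|)%N by apply/card_gt0P; exists k.
have Ux : U x by apply: orthU; case: xI.
have dP := P_differentiable Ux.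
have pd z c : pairing z (c *: delta_mx i 0) = c * z 0 i.
  rewrite /pairing (bigD1 i) //= big1 ?addr0.
    by rewrite !mxE !eqxx mulr1 mulrC.
  by move=> q qi; rewrite !mxE (negPf qi) mulr0 mulr0.
have im t : 0 < t <= 1 -> (P (x + t *: delta_mx 0 k)) 0 i = 0.
  move=> /andP[t0 _]; have [_] : face I (P (x + t *: delta_mx 0 k)); last exact.
  apply: face_image => //; split => [q|q qI].
    by rewrite !mxE addr_ge0 ?(xI.1 q) // mulr_ge0 // ltW.
  rewrite !mxE (xI.2 _ qI) (_ : q == k = false) ?mulr0 ?addr0 //.
  by apply: contraNF qI => /eqP ->.
have im0 : P x 0 i = 0 by have [_] := face_image I0 xI; exact.
(* Taken with [c = 1] and [c = -1], the one-sided inequality forces the derivative to vanish. *)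
have h c : c * ('D_(delta_mx 0 k) P x) 0 i <= 0.
  rewrite -pd; apply: pairing_derive_le0 => // t /im imt.
  by rewrite !pd imt im0.
rewrite jacobian_entry //; apply/eqP; rewrite eq_le.
by have := h 1; have := h (-1); rewrite mulN1r mul1r oppr_le0 => -> ->.
Qed.

Definition proj_face I : 'M[R]_N := \matrix_(a, b) ((a == b) && (a \in I))%:R.

Lemma mul_proj_face m I (A : 'M[R]_(m, N)) a b :
  (A *m proj_face I) a b = A a b * (b \in I)%:R.
Proof.
rewrite mxE (bigD1 b) //= big1 ?addr0 ?mxE ?eqxx //.
by move=> q qb; rewrite mxE (negPf qb) mulr0.
Qed.

Lemma proj_face_mul m I (A : 'M[R]_(N, m)) a b :
  (proj_face I *m A) a b = (a \in I)%:R * A a b.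
Proof.
rewrite mxE (bigD1 a) //= big1 ?addr0 ?mxE ?eqxx //.
by move=> q qb; rewrite mxE eq_sym (negPf qb) mul0r.
Qed.

(** [DP(x)] maps [V_I], the row space of [proj_face I], injectively into itself, hence onto it by
    equality of ranks, so the inverse preserves [V_I] too. *)
Lemma invD_face0 I x k i : face I x -> k \in I -> i \notin I ->
  invD x k i = 0.
Proof.
move=> xI kI iI; have Ux : U x by apply: orthU; case: xI.
have Ju := jacobianP_unit Ux.
have sub : (proj_face I *m jacobian P x <= proj_face I)%MS.
  apply/submxP; exists (proj_face I *m jacobian P x).
  apply/matrixP => a b; rewrite mul_proj_face proj_face_mul.
  have [aI|] := boolP (a \in I); last by rewrite !mul0r.
  have [bI|bI] := boolP (b \in I); first by rewrite mulr1.
  by rewrite (jacobian_face0 xI aI bI) !mulr0.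
have /eqmxP eqI : (proj_face I *m jacobian P x == proj_face I)%MS.
  by rewrite -(mxrank_leqif_eq sub) mxrankMfree // row_free_unit.
have : (proj_face I *m invD x <= proj_face I)%MS.
  rewrite -(eqmxMr (invD x) eqI) -mulmxA mul_invD // mulmx1.
  exact: submx_refl.
move=> /submxP[D /matrixP /(_ k i)].
by rewrite proj_face_mul mul_proj_face kI (negPf iI) mul1r mulr0.
Qed.

(** On the line [V_(I + j) / V_I] the derivative acts by its [(j, j)] entry and the inverse by the
    reciprocal. In the [(j, j)] entry of the product, all terms but [k = j] vanish by invariance of
    the two faces. *)
Lemma jacobian_invD_diag I x j : face I x -> j \notin I ->
  jacobian P x j j * invD x j j = 1.
Proof.
move=> xI jI; have Ux : U x by apply: orthU; case: xI.
have xJ : face (j |: I)%SET x.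
  split=> [|q]; first by case: xI.
  by rewrite in_setU1 negb_or => /andP[_ qI]; apply: xI.2.
have /matrixP /(_ j j) := mul_invD Ux; rewrite mxE [RHS]mxE eqxx mulr1n => <-.
rewrite (bigD1 j) //= big1 ?addr0 // => k kj.
have [kI|kI] := boolP (k \in I); first by rewrite (invD_face0 xI kI jI) mulr0.
rewrite (jacobian_face0 xJ) ?mul0r // in_setU1 ?eqxx //.
by rewrite negb_or kj.
Qed.

End InverseDerivative.

(** * Transport of supporting functionals along an orbit *)

Section Cocycles.
Context {R : realType} {N : nat}.
Local Notation V := 'rV[R]_N.
Implicit Types (T : V -> V) (M : V -> 'M[R]_N).

Fixpoint cocycle T M n x : 'M[R]_N :=
  if n is n'.+1 then cocycle T M n' x *m M (iter n' T x) else 1%:M.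

Lemma iter_skew_product T M n x v :
  iter n (fun xv : V * V => (T xv.1, xv.2 *m M xv.1)) (x, v) =
  (iter n T x, v *m cocycle T M n x).
Proof.
by elim: n => [|n IH]; rewrite /= ?mulmx1 // IH /= mulmxA.
Qed.

Lemma cocycle_inj T M n x : (forall k, M (iter k T x) \in unitmx) ->
  forall v : V, v *m cocycle T M n x = 0 -> v = 0.
Proof.
move=> Mu; elim: n => [|n IH] v /=; first by rewrite mulmx1.
rewrite mulmxA => /(congr1 (mulmx^~ (invmx (M (iter n T x))))).
by rewrite mulmxK // mul0mx => /IH.
Qed.

End Cocycles.

Section CarryingSimplex.
Context {R : realType} {N : nat}.
Local Notation V := 'rV[R]_N.
Context (P g : V -> V) (U : set V).
Context (Pg : C2_inverse P g U).
Context (H2 : faces_invariant P) (H3 : inverse_derivative_positive P).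
Context (S : set V) (S_cs : carrying_simplex P S).
Context (S_convex : convex_set (cone_over S : set (convex_lmodType V))).
Context (I : {set 'I_N}) (j : 'I_N) (jNI : j \notin I).
Context (I_gt0 : (0 < #|I|)%N).
Implicit Types (x v : V) (L : 'cV[R]_N).

Local Notation invD := (invD P).
Local Notation G := (cone_over S).
Local Notation F := (S `&` face I).

Let orthU : orthant `<=` U. Proof. by case: Pg => _ h _ _ _; exact: h. Qed.
Let gP x : U x -> g (P x) = x. Proof. by case: Pg => _ _ _ _ h; exact: h. Qed.

Lemma S_orthant : S `<=` orthant.
Proof. by case: S_cs => -[_ h _] _ _ _ _; exact: h. Qed.

Lemma S_dom : S `<=` U.
Proof. by move=> x /S_orthant /orthU. Qed.

Lemma S_image x : S x -> S (P x).
Proof. by case: S_cs => -[_ _ PS] _ _ _ _ Sx; rewrite -PS; exists x. Qed.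

Lemma S_preimage x : orthant x -> S (P x) -> S x.
Proof.
case: S_cs => -[_ _ PS] _ _ _ _ x0; rewrite -{1}PS => -[y Sy Pyx].
by rewrite -(gP (orthU x0)) -Pyx gP //; exact: S_dom.
Qed.

Lemma F_image x : F x -> F (P x).
Proof.
by move=> [Sx xI]; split; [exact: S_image|exact: (face_image H2)].
Qed.

Lemma F_iter n x : F x -> F (iter n P x).
Proof. by move=> Fx; elim: n => //= n; exact: F_image. Qed.

Lemma F_preimage x : orthant x -> F (P x) -> F x.
Proof.
move=> x0 [SPx fPx]; split; first exact: S_preimage.
by have [_] := H2 I_gt0 (or_introl (erefl (face I))); apply.
Qed.

Lemma cone_orthant : G `<=` orthant.
Proof. by case: S_cs => _ _ _ _ [_ h _ _]; exact: h. Qed.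

Lemma cone_compact : compact G.
Proof. by case: S_cs => _ _ _ _ [h _ _ _]; exact: h. Qed.

Lemma cone_image : P @` G = G.
Proof. by case: S_cs => _ _ _ _ [_ _ h _]; exact: h. Qed.

Lemma S_compact : compact S.
Proof. by case: S_cs => -[h _ _] _ _ _ _; exact: h. Qed.

Lemma sub_cone x : S x -> G x.
Proof. by move=> Sx; exists 1, x; rewrite scale1r lexx ler01. Qed.

Lemma cone_convex : convex_subset G.
Proof.
move=> y z t t01 Gy Gz.
have := S_convex (Itv01 (andP t01).1 (andP t01).2) (mem_set Gz) (mem_set Gy).
move/set_mem; congr cone_over.
rewrite /conv /= /unstable.onem scalerBl scale1r scalerBr.
by rewrite addrC -addrA; congr (_ + _); rewrite addrC.
Qed.

(** A point of the cone lies below the point of [S] on its ray; if it were strictly above [x] in all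
    coordinates, so would be that point, and two points of [S] would be related by [<<]. *)
Lemma cone_not_above x y : S x -> G y -> exists i, y 0 i <= x 0 i.
Proof.
move=> Sx [a [s [/andP[a0 a1] Ss ->]]]; apply: contrapT => no.
case: S_cs => _ _ [/(_ _ _ Sx Ss) + _] _ _; apply => i _.
rewrite ltNge; apply/negP => le; apply: no; exists i.
apply: le_trans le; rewrite mxE ler_piMl //; exact: S_orthant.
Qed.

Lemma normal_at_S x : S x -> exists L, normal_at G x L.
Proof.
move=> Sx; apply: normal_exists.
- exact: cone_compact.
- exact: cone_convex.
- exact: sub_cone.
- by move=> y; exact: cone_not_above.
Qed.

(** The vertex [k] of the standard simplex is the radial projection of some point of [S]. *)
Lemma axis_point k : exists2 s : R, 0 < s & G (s *: delta_mx 0 k).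
Proof.
case: S_cs => _ [[_ _ surj] _ _] _ _ _.
have [|y Sy yk] := surj (delta_mx 0 k).
  split=> [i|]; first by rewrite mxE ler0n.
  rewrite /= (bigD1 k) //= big1 ?mxE ?eqxx ?addr0 //.
  by move=> i ik; rewrite mxE (negPf ik).
have y0 : 0 <= \sum_i y 0 i by apply: sumr_ge0 => i _; exact: S_orthant.
have yn0 : \sum_i y 0 i != 0.
  apply/eqP => ys; move/matrixP: yk => /(_ 0 k).
  by rewrite !mxE ys invr0 mul0r !eqxx => /esym/eqP; rewrite oner_eq0.
exists (\sum_i y 0 i); first by rewrite lt_neqAle eq_sym yn0.
by rewrite -yk /radial scalerA divff // scale1r; exact: sub_cone.
Qed.

Lemma pairing_scale_delta (s : R) k L :
  pairing (s *: delta_mx 0 k) L = s * L k 0.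
Proof.
rewrite /pairing (bigD1 k) //= big1 ?addr0 ?mxE ?eqxx ?mulr1 //.
by move=> i ik; rewrite !mxE (negPf ik) mulr0 mul0r.
Qed.

(* The derivative of [g] at [P x] maps a direction from [P x] into the
   invariant convex set [G] to one from [x] into [G]. *)
Lemma normal_step x L : S x -> normal_at G x L ->
  normal_at G (P x) (invD x *m L).
Proof.
move=> Sx [L0 Ln0 LG]; have Ux := S_dom Sx; split.
- move=> i; rewrite mxE; apply: sumr_ge0 => k _; apply: mulr_ge0 => //.
  by apply: (invD_ge0 Pg H3); exact: S_orthant.
- apply: contra_neq Ln0 => /(congr1 (mulmx (jacobian P x))).
  by rewrite mulmxA (mul_invD Pg Ux) mul1mx mulmx0.
move=> y Gy.
suff : pairing ('D_(y - P x) g (P x)) L <= 0.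
  rewrite deriveEjacobian; last exact: (g_differentiable Pg).
  rewrite -(invDE Pg Ux) !pairingE !mulmxBl.
  have subE (A B : 'M[R]_1) : (A - B) 0 0 = A 0 0 - B 0 0 by rewrite !mxE.
  by rewrite subE subr_le0 !mulmxA.
apply: pairing_derive_le0; first exact: (g_differentiable Pg).
move=> t /andP[t0 t1].
have GPx : G (P x) by apply/sub_cone/S_image.
have : G (P x + t *: (y - P x)) by apply: cone_convex; rewrite // t1 ltW.
rewrite -{1}cone_image => -[z Gz <-].
by rewrite gP ?(gP Ux); [exact: LG|exact/orthU/cone_orthant].
Qed.

(** Acting on columns, it pushes functionals at [x] forward to [P^n x]; acting on rows, it carries
    vectors at [P^n x] back to [x]. *)
Fixpoint invDn n x : 'M[R]_N :=
  if n is n'.+1 then invD (iter n' P x) *m invDn n' x else 1%:M.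

Lemma normal_iter n x L : F x -> normal_at G x L ->
  normal_at G (iter n P x) (invDn n x *m L).
Proof.
move=> Fx nL; elim: n => [|n IH] /=; first by rewrite mul1mx.
rewrite -mulmxA; apply: normal_step => //; exact: (F_iter n Fx).1.
Qed.

Definition massI L : R := \sum_(i in I) L i 0.

Lemma pairing_face x L : face I x -> pairing x L = \sum_(i in I) x 0 i * L i 0.
Proof.
move=> [_ xI]; rewrite /pairing [RHS]big_mkcond /=; apply: eq_bigr => i _.
by case: ifPn => // /xI ->; rewrite mul0r.
Qed.

(** Testing the supporting inequality at a point [s * e_j] of the cone gives [s * L_j <= <x, L>],
    and [<x, L>] only involves the mass on [I] because [x] lies in the face. *)
Lemma entry_bound : exists2 b : R, 1 <= b &
  forall x L, F x -> normal_at G x L -> L j 0 <= b * massI L.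
Proof.
have [s s0 Gs] := axis_point j.
have [B B1 SB] : exists2 B, 0 <= B & forall x, S x -> `|x| <= B.
  have [M [_ /(_ (Num.max 0 M + 1))]] : bounded_set S.
    by apply: compact_bounded; exact: S_compact.
  move=> h; exists (Num.max 0 M + 1); first by rewrite addr_ge0 ?le_max ?lexx.
  apply: h; rewrite ltr_pwDr // le_max lexx orbT //.
exists (Num.max 1 (B / s)); first by rewrite le_max lexx.
move=> x L [Sx xI] [L0 _ LG].
have m0 : 0 <= massI L by apply: sumr_ge0.
apply: le_trans (_ : B / s * massI L <= _); last first.
  by apply: ler_wpM2r => //; rewrite le_max lexx orbT.
rewrite mulrAC ler_pdivlMr // mulrC -pairing_scale_delta.
apply: le_trans (LG _ Gs) _; rewrite pairing_face // mulr_sumr.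
apply: ler_sum => i _; apply: ler_wpM2r => //.
by apply: le_trans (ler_norm _) (le_trans (coord_le_norm x i) (SB _ Sx)).
Qed.

(** Without mass on [I] the pairing of [x] with [L] is 0, and testing at the axis points makes every
    entry of [L] nonpositive, so [L = 0]. *)
Lemma massI_gt0 x L : F x -> normal_at G x L -> 0 < massI L.
Proof.
move=> [Sx xI] [L0 Ln0 LG]; rewrite lt_neqAle sumr_ge0 ?andbT; last first.
  by move=> i _; exact: L0.
apply: contra_neq Ln0 => /esym mL.
have LI i : i \in I -> L i 0 = 0.
  move=> iI; move/eqP: mL; rewrite psumr_eq0 // => /allP /(_ i).
  by rewrite mem_index_enum iI => /(_ isT) /eqP.
have pL : pairing x L = 0.
  by rewrite pairing_face // big1 // => i /LI ->; rewrite mulr0.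
apply/colP => k; rewrite [RHS]mxE; apply/eqP; rewrite eq_le L0 andbT.
have [s s0 /LG] := axis_point k.
by rewrite pairing_scale_delta pL pmulr_rle0.
Qed.

Lemma invD_bound : exists2 c : R, 1 <= c & forall x k i, S x -> invD x k i <= c.
Proof.
pose f x := \sum_k \sum_i invD x k i.
have [M [_ /(_ (Num.max 1 M + 1))]] : bounded_set (f @` S).
  apply/compact_bounded/continuous_compact; last exact: S_compact.
  apply/subspace_continuousP => x Sx; apply: cvg_within_filter.
  apply: continuous_sumr => k _; apply: continuous_sumr => i _.
  exact: (invD_continuous Pg (S_dom Sx)).
move=> h; exists (Num.max 1 M + 1).
  by rewrite -[leLHS]addr0 lerD // le_max lexx.
move=> x k i Sx.
have ge0 k' i' : 0 <= invD x k' i'.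
  by apply: (invD_ge0 Pg H3); exact: S_orthant.
apply: le_trans (_ : f x <= _).
  rewrite /f (bigD1 k) //= (bigD1 i) //= -addrA lerDl addr_ge0 ?sumr_ge0 //.
  by move=> k' _; rewrite sumr_ge0.
apply: le_trans (ler_norm _) _; apply: h; last by exists x.
by rewrite ltr_pwDr // le_max lexx orbT.
Qed.

Lemma S_invD_ge0 x k i : S x -> 0 <= invD x k i.
Proof. by move=> Sx; apply: (invD_ge0 Pg H3); exact: S_orthant. Qed.

Lemma normal_ge0 x L i : normal_at G x L -> 0 <= L i 0.
Proof. by case. Qed.

(* From [x] to [P (P x)], a supporting functional transfers at least the
   proportion [kappa] of its mass on [I] to the entry [j]. *)
Definition good_set kappa : set V := F `&`
  [set x | forall k, k \in I ->
     kappa <= \sum_(i in I) invD (P x) j i * invD x i k].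

Lemma entry_step x L : S x -> normal_at G x L ->
  invD x j j * L j 0 + \sum_(i in I) invD x j i * L i 0 <= (invD x *m L) j 0.
Proof.
move=> Sx [L0 _ _].
rewrite [leRHS]mxE [leRHS](bigD1 j) //= lerD2l big_mkcond /=.
rewrite [leRHS]big_mkcond /=; apply: ler_sum => i _.
have [iI|_] := boolP (i \in I).
  by case: eqVneq iI => // -> /idPn; rewrite jNI.
by case: ifP => // _; rewrite mulr_ge0 // S_invD_ge0.
Qed.

(** By invariance of [V_I], the entries on [I] of the new functional depend only on the entries of
    [L] on [I]. *)
Lemma massI_step c x L : (forall k i, invD x k i <= c) -> F x ->
  normal_at G x L -> massI (invD x *m L) <= N%:R * c * massI L.
Proof.
move=> ic [Sx xI] [L0 _ _].
have stepE i : i \in I -> (invD x *m L) i 0 = \sum_(k in I) invD x i k * L k 0.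
  move=> iI; rewrite mxE [RHS]big_mkcond; apply: eq_bigr => k _.
  by case: ifPn => // kI; rewrite (invD_face0 Pg H2 xI iI kI) mul0r.
apply: le_trans (_ : \sum_(i in I) c * massI L <= _).
  apply: ler_sum => i iI; rewrite stepE // mulr_sumr.
  by apply: ler_sum => k _; exact: ler_wpM2r.
rewrite sumr_const -[leLHS]mulr_natl -[leRHS]mulrA.
apply: ler_wpM2r; last first.
  by rewrite ler_nat -[leqRHS]card_ord max_card.
have c0 : 0 <= c by apply: le_trans (ic j j); exact: S_invD_ge0.
by rewrite mulr_ge0 // sumr_ge0.
Qed.

(** The additive gain [kappa * massI L] becomes a multiplicative one, because the quantity it is
    added to is itself at most a constant [D] times [massI L]. *)
Lemma good_gain kappa : 0 < kappa -> exists2 gain, 0 < gain &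
  forall x L, good_set kappa x -> normal_at G x L ->
  let L1 := invD x *m L in let L2 := invD (P x) *m L1 in
  kappa * massI L <= L2 j 0 /\
  invD (P x) j j * L1 j 0 * (1 + gain) <= L2 j 0.
Proof.
move=> kappa0; have [b b1 hb] := entry_bound; have [c c1 hc] := invD_bound.
have N0 : 0 < N%:R :> R by rewrite ltr0n (leq_ltn_trans _ (ltn_ord j)).
have b0 : 0 < b by lra.
have c0 : 0 < c by lra.
(* The outer [c] bounds the [(j, j)] entry at [P x], [b] compares the entry [j] with the mass on
   [I], and [N * c] bounds the growth of that mass in one step. *)
pose D := c * (b * (N%:R * c)).
have D0 : 0 < D by rewrite !mulr_gt0.
exists (kappa / D); first exact: divr_gt0.
move=> x L [Fx gx] nL L1 L2.
have Sx := Fx.1; have SPx := S_image Sx.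
have n1 : normal_at G (P x) L1 by exact: normal_step.
have gainI : kappa * massI L <= \sum_(i in I) invD (P x) j i * L1 i 0.
  have -> : \sum_(i in I) invD (P x) j i * L1 i 0 =
    \sum_(k in I) (\sum_(i in I) invD (P x) j i * invD x i k) * L k 0.
    under eq_bigr => i iI.
      have -> : L1 i 0 = \sum_(k in I) invD x i k * L k 0.
        rewrite mxE [RHS]big_mkcond; apply: eq_bigr => k _.
        by case: ifPn => // kI; rewrite (invD_face0 Pg H2 Fx.2 iI kI) mul0r.
      rewrite mulr_sumr; under eq_bigr do rewrite mulrA.
      over.
    rewrite exchange_big /=; apply: eq_bigr => k _.
    by rewrite mulr_suml.
  rewrite mulr_sumr; apply: ler_sum => k kI; apply: ler_wpM2r; last exact: gx.
  exact: normal_ge0 nL.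
have step2 := entry_step SPx n1.
have a0 : 0 <= invD (P x) j j * L1 j 0.
  by rewrite mulr_ge0 ?S_invD_ge0 //; exact: normal_ge0 n1.
have aD : invD (P x) j j * L1 j 0 <= D * massI L.
  rewrite /D -mulrA; apply: ler_pM.
  - exact: S_invD_ge0.
  - exact: normal_ge0 n1.
  - exact: hc.
  apply: le_trans (hb _ _ (F_image Fx) n1) _; rewrite -mulrA ler_pM2l //.
  by apply: massI_step => // *; exact: hc.
split; first by apply: le_trans step2; lra.
rewrite mulrDr mulr1; apply: le_trans step2; rewrite lerD2l.
apply: le_trans gainI; rewrite mulrCA ler_pM2l // ler_pdivrMr //.
by rewrite [leRHS]mulrC.
Qed.

Definition visits (A : set V) x n : nat := \sum_(k < n) (iter k.+1 P x \in A).

Lemma entry_growth kappa gain x L n : 0 < gain ->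
  (forall x L, good_set kappa x -> normal_at G x L ->
    kappa * massI L <= (invD (P x) *m (invD x *m L)) j 0 /\
    invD (P x) j j * (invD x *m L) j 0 * (1 + gain) <=
      (invD (P x) *m (invD x *m L)) j 0) ->
  good_set kappa x -> normal_at G x L ->
  kappa * massI L * (\prod_(k < n) invD (iter k.+2 P x) j j *
    (1 + gain) ^+ visits (good_set kappa) x n) <= (invDn n.+2 x *m L) j 0.
Proof.
move=> gain0 hg gx nL; have Fx := gx.1.
elim: n => [|n IH].
  have -> : invDn 2 x *m L = invD (P x) *m (invD x *m L).
    by rewrite [invDn 2 x]/= (mulmx1 (invD x)) mulmxA.
  rewrite /visits big_ord0 big_ord0 expr0 mulr1 mulr1.
  exact: (hg _ _ gx nL).1.
have Fn : F (iter n.+1 P x) := F_iter n.+1 Fx.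
have nLn : normal_at G (iter n.+1 P x) (invDn n.+1 x *m L).
  exact: normal_iter.
have nL2 : normal_at G (iter n.+2 P x) (invDn n.+2 x *m L).
  exact: normal_iter.
have S2 : S (iter n.+2 P x) by exact: (F_iter n.+2 Fx).1.
have d0 : 0 <= invD (iter n.+2 P x) j j by exact: S_invD_ge0.
have eqL : invDn n.+3 x *m L = invD (iter n.+2 P x) *m (invDn n.+2 x *m L).
  by rewrite mulmxA.
(* The transfer takes two steps: a visit at time [n + 1] pays off in passing from time [n + 2] to
   [n + 3]. This explains the shifts in [visits] and in the product. *)
have key : invD (iter n.+2 P x) j j * (invDn n.+2 x *m L) j 0 *
    (1 + gain) ^+ (iter n.+1 P x \in good_set kappa) <= (invDn n.+3 x *m L) j 0.
  rewrite eqL; have [/set_mem gn|_] := boolP (_ \in _).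
    rewrite expr1; have := (hg _ _ gn nLn).2.
    by rewrite [invD (iter n.+1 P x) *m (_ *m _)]mulmxA.
  rewrite expr0 mulr1; apply: le_trans (entry_step S2 nL2).
  rewrite lerDl sumr_ge0 // => i _; rewrite mulr_ge0 ?S_invD_ge0 //.
  exact: normal_ge0 nL2.
apply: le_trans key.
rewrite /visits !big_ord_recr /= exprD.
set p := \prod_(k < n) _; set q := (1 + gain) ^+ _; set r := (1 + gain) ^+ _.
have r0 : 0 <= r by apply: exprn_ge0; lra.
have -> : kappa * massI L * (p * invD (P (P (iter n P x))) j j * (q * r)) =
  (invD (P (P (iter n P x))) j j * (kappa * massI L * (p * q))) * r by ring.
by apply: ler_wpM2r => //; apply: ler_wpM2l.
Qed.

Definition onesI : V := \row_i (i \in I)%:R.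

Lemma invDn_face n x v : F x -> coord_space I v ->
  coord_space I (v *m invDn n x).
Proof.
elim: n v => [|n IH] v Fx vI /=; first by rewrite mulmx1.
rewrite mulmxA; apply: IH => // i iI; rewrite mxE big1 // => k _.
have [kI|kI] := boolP (k \in I); last by rewrite vI ?mul0r.
by rewrite (invD_face0 Pg H2 (F_iter n Fx).2 kI iI) mulr0.
Qed.

Lemma onesI_face : coord_space I onesI.
Proof. by move=> i iI; rewrite mxE (negPf iI). Qed.

(** The mass on [I] is the pairing with the vector [onesI]. By duality, the mass of the pushed
    functional is the pairing of [L] with [onesI] carried back to [x], a vector still supported in
    [I]. *)
Lemma massI_invDn n x L : F x -> normal_at G x L ->
  massI (invDn n x *m L) <= `|onesI *m invDn n x| * massI L.
Proof.
move=> Fx nL; have wI := @invDn_face n _ _ Fx onesI_face.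
set w := onesI *m invDn n x in wI *.
have -> : massI (invDn n x *m L) = (w *m L) 0 0.
  rewrite /w -mulmxA [RHS]mxE /massI big_mkcond; apply: eq_bigr => i _.
  by rewrite [onesI 0 i]mxE; case: ifP => _; rewrite ?mul1r ?mul0r.
rewrite mxE /massI mulr_sumr [leRHS]big_mkcond; apply: ler_sum => k _.
case: ifPn => [kI|/wI ->]; last by rewrite mul0r.
apply: ler_wpM2r; first exact: normal_ge0 nL.
exact: le_trans (ler_norm _) (coord_le_norm _ _).
Qed.

(** The lower bound from the diagonal entries and visits meets the upper bound by the mass on [I].
    Both are proportional to [massI L > 0], which cancels, so the constants depend neither on [L]
    nor on [x] and [n]. *)
Lemma external_product_bound kappa : 0 < kappa ->
  exists gain D, [/\ 0 < gain, 0 < D & forall x n, good_set kappa x ->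
    \prod_(k < n.+2) invD (iter k P x) j j *
      (1 + gain) ^+ visits (good_set kappa) x n <=
    D * `|onesI *m invDn n.+2 x| ].
Proof.
move=> kappa0; have [gain gain0 hg] := good_gain kappa0.
have [b b1 hb] := entry_bound; have [c c1 hc] := invD_bound.
have c0 : 0 < c by lra.
have b0 : 0 < b by lra.
have g1 : 0 <= 1 + gain by lra.
exists gain, (c * c * b / kappa); split => //.
  by rewrite divr_gt0 // !mulr_gt0.
move=> x n gx; have Fx := gx.1; have [L nL] := normal_at_S Fx.1.
have m0 := massI_gt0 Fx nL.
have lower := entry_growth n gain0 hg gx nL.
have upper := hb _ _ (F_iter n.+2 Fx) (normal_iter n.+2 Fx nL).
have {}upper := le_trans upper (ler_wpM2l (ltW b0) (massI_invDn n.+2 Fx nL)).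
have := le_trans lower upper.
set w := `|_|; set q := (1 + gain) ^+ _.
have -> : \prod_(k < n.+2) invD (iter k P x) j j =
  invD x j j * invD (P x) j j * \prod_(k < n) invD (iter k.+2 P x) j j.
  by rewrite !big_ord_recl /= mulrA.
set p := \prod_(k < n) _ => h.
have p0 : 0 <= p.
  by apply: prodr_ge0 => k _; apply: S_invD_ge0; exact: (F_iter k.+2 Fx).1.
have q0 : 0 <= q by exact: exprn_ge0.
have h1 : kappa * (p * q) <= b * w.
  by rewrite -(ler_pM2r m0); move: h; rewrite mulrAC -!mulrA.
(* The growth estimate starts at time 2; the two missing factors of the product cost at most
   [c * c]. *)
have h2 : invD x j j * invD (P x) j j <= c * c.
  have Sx := Fx.1; have SPx := S_image Sx.
  by apply: ler_pM; rewrite ?S_invD_ge0 ?hc.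
apply: le_trans (_ : c * c * (p * q) <= _).
  by rewrite -[leLHS]mulrA; apply: ler_wpM2r => //; rewrite mulr_ge0.
have -> : c * c * b / kappa * w = c * c * ((b * w) / kappa).
  by field; rewrite gt_eqF.
apply: ler_wpM2l; first by rewrite mulr_ge0 // ltW.
by rewrite ler_pdivlMr // mulrC.
Qed.

End CarryingSimplex.

(** * Closed and measurable sets attached to a face *)

Lemma continuous_prodr {R : realType} {T : topologicalType} (I : finType)
    (p : pred I) (f : I -> T -> R) (x : T) :
  (forall i, p i -> {for x, continuous (f i)}) ->
  {for x, continuous (fun z => \prod_(i | p i) f i z)}.
Proof. by move=> h; apply: cvg_big => //; exact: mul_continuous. Qed.

(** Continuity is asked only at points of [F], as [P] is arbitrary far from the orthant. *)
Lemma closed_setI_preimage {T U : topologicalType} (F : set T) (f : T -> U)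
    (D : set U) : closed F -> closed D ->
  (forall x, F x -> {for x, continuous f}) -> closed (F `&` f @^-1` D).
Proof.
move=> Fcl Dcl fc x xcl.
have Fx : F x by apply: Fcl => A /xcl [y [[Fy _] Ay]]; exists y.
split => //; apply: contrapT => nD.
have : nbhs (f x) (~` D).
  by apply: open_nbhs_nbhs; split => //; exact: closed_openC.
by move=> /(fc _ Fx) /xcl [y [[_ Dy]]].
Qed.

Section FaceTopology.
Context {R : realType} {N : nat}.
Local Notation V := 'rV[R]_N.

Lemma face_closed (I : {set 'I_N}) : closed (face I : set V).
Proof.
apply: closedI.
  have -> : orthant = \bigcap_i [set x : V | 0 <= x 0 i].
    by apply/seteqP; split => [x h i _|x h i]; [exact: h|exact: (h i)].
  apply: closed_bigI => i _.
  apply: (@preimage_closed _ _ (fun x : V => x 0 i) [set r : R | 0 <= r]).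
    by move=> x _; exact: coord_continuous.
  exact: closed_ge.
have -> : coord_space I =
    \bigcap_(i in [set i | i \notin I]) [set x : V | x 0 i = 0].
  by apply/seteqP; split => x h i; exact: h.
apply: closed_bigI => i _.
apply: (@preimage_closed _ _ (fun x : V => x 0 i) [set r : R | r = 0]).
  by move=> x _; exact: coord_continuous.
exact: closed_eq.
Qed.

Lemma face_int_measurable (S : set V) (I : {set 'I_N}) : closed S ->
  measurable (S `&` face_int I : set (borel_rV R N)).
Proof.
move=> Scl.
have -> : S `&` face_int I = (S `&` face I) `&`
    \bigcap_(i in [set i | i \in I]) [set x : V | 0 < x 0 i].
  by rewrite -setIA; apply/seteqP; split => x [Sx [xI xp]].
apply: measurableI.
  by apply: closed_measurable_rV; apply: closedI => //; exact: face_closed.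
apply: fin_bigcap_measurable => // i _.
apply: sub_sigma_algebra.
apply: (@open_comp _ _ (fun x : V => x 0 i) [set r : R | 0 < r]).
  by move=> x _; exact: coord_continuous.
exact: open_gt.
Qed.

End FaceTopology.

Lemma ae_of_probability1 {d} {T : measurableType d} {R : realType}
    (mu : probability T R) (A : set T) : measurable A -> mu A = 1%E ->
  {ae mu, forall x, A x}.
Proof.
move=> mA A1; exists (~` A); split => //; first exact: measurableC.
by rewrite probability_setC // A1 subee.
Qed.

(** * Comparison of the exponents *)

Section Exponents.
Context {R : realType} {N : nat}.
Local Notation V := 'rV[R]_N.
Context (P g : V -> V) (U : set V) (Pg : C2_inverse P g U).
Context (H2 : faces_invariant P) (H3 : inverse_derivative_positive P).
Context (S : set V) (S_cs : carrying_simplex P S).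
Context (S_convex : convex_set (cone_over S : set (convex_lmodType V))).
Context (I : {set 'I_N}) (j : 'I_N) (jNI : j \notin I).
Context (I_gt0 : (0 < #|I|)%N).
Implicit Types (x v : V).

Local Notation invD := (invD P).
Local Notation F := (S `&` face I).
Local Notation Q := ('pinv_(fun=> 0) S P).
Local Notation DPn := (cocycle P (jacobian P)).
Local Notation DQn := (cocycle Q (fun y => invmx (jacobian P (Q y)))).

Let gP x : U x -> g (P x) = x. Proof. by case: Pg => _ _ _ _ h; exact: h. Qed.
Let SU : S `<=` U. Proof. exact: (S_dom Pg S_cs). Qed.
Let S_iter n x : S x -> S (iter n P x).
Proof. by move=> Sx; elim: n => //= n; exact: (S_image S_cs). Qed.

Lemma pinvP x : S x -> Q (P x) = x.
Proof.
move=> Sx; apply: pinvKV; last exact: mem_set.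
by move=> y z /set_mem Sy /set_mem Sz /(congr1 g); rewrite !gP //; exact: SU.
Qed.

Lemma S_preimage_in x : S x -> exists2 y, S y & P y = x.
Proof.
by case: S_cs => -[_ _ PS] _ _ _ _; rewrite -{1}PS => -[y Sy <-]; exists y.
Qed.

Lemma S_pinv x : S x -> S (Q x).
Proof. by move=> /S_preimage_in[y Sy <-]; rewrite pinvP. Qed.

Lemma DPn_inj x n v : S x -> v *m DPn n x = 0 -> v = 0.
Proof.
move=> Sx; apply: cocycle_inj => k.
by apply: (jacobianP_unit Pg); apply/SU/S_iter.
Qed.

Lemma DQn_inj x n v : S x -> v *m DQn n x = 0 -> v = 0.
Proof.
move=> Sx; apply: cocycle_inj => k; rewrite unitmx_inv.
apply: (jacobianP_unit Pg); apply/SU/S_pinv.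
by elim: k => //= k; exact: S_pinv.
Qed.

Lemma invDnSr n x : invDn P n.+1 x = invDn P n (P x) *m invD x.
Proof.
elim: n => [|n IH]; first by rewrite /= mul1mx mulmx1.
rewrite [LHS]/= -[invD (iter n P x) *m _]/(invDn P n.+1 x) IH mulmxA.
by rewrite [in RHS]/= -iterSr.
Qed.

(** Identifies the backward cocycle of the Lyapunov exponents, started at the end point [P^n x],
    with the matrix that transports supporting functionals from [x]. *)
Lemma DQn_iter n x : S x -> DQn n (iter n P x) = invDn P n x.
Proof.
elim: n x => [//|n IH] x Sx.
have Qn m y : S y -> iter m Q (iter m P y) = y.
  elim: m y => // m IHm y Sy; rewrite iterS [iter m.+1 P y]iterSr IHm //.
    exact: pinvP.
  exact: (S_image S_cs).
rewrite invDnSr invD_invmx -(IH (P x)); last exact: (S_image S_cs).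
rewrite [LHS]/= -iterS iterSr Qn ?pinvP //; exact: (S_image S_cs).
Qed.

Lemma has_exponent_two_sided x v l : has_exponent P S x v l ->
  two_sided_exponent (DPn^~ x) (DQn^~ x) v l.
Proof.
have fE n : (iter n (Defs.skew P) (x, v)).2 = v *m DPn n x.
  exact: (congr1 (fun p : V * V => p.2)
    (iter_skew_product P (jacobian P) n x v)).
have bE n : (iter n (skew_inv P S) (x, v)).2 = v *m DQn n x.
  exact: (congr1 (fun p : V * V => p.2)
    (iter_skew_product Q (fun y => invmx (jacobian P (Q y))) n x v)).
rewrite /has_exponent.
under eq_fun do rewrite fE.
by under [X in _ /\ (X @ _ --> _)]eq_fun do rewrite bE.
Qed.

Lemma lyapunov_splitting (mu : probability (borel_rV R N) R) J s :
  lyapunov_exponents P S mu J s ->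
  {ae mu, forall x : V, exists E,
     oseledets_splitting (DPn^~ x) (DQn^~ x) (coord_space J) s E}.
Proof.
move=> [Z [mZ Z0 sZ]]; exists Z; split => //; apply: subset_trans sZ.
apply: subsetC => x [E [_ EJ dimE Eexp]]; exists E; split => // l v ls vE v0.
by apply: has_exponent_two_sided; exact: Eexp.
Qed.

(** Vectors of [V_I] never contribute to the coordinate [j], so along the orbit this coordinate is
    just multiplied by the [(j, j)] entries. *)
Lemma DPn_external x n v : F x -> coord_space (j |: I)%SET v ->
  coord_space (j |: I)%SET (v *m DPn n x) /\
  (v *m DPn n x) 0 j = v 0 j * \prod_(k < n) jacobian P (iter k P x) j j.
Proof.
move=> Fx vJ; elim: n => [|n [IHJ IHj]] /=.
  by rewrite mulmx1 big_ord0 mulr1.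
have Fn := F_iter H2 S_cs I_gt0 n Fx.
have fJ : face (j |: I)%SET (iter n P x).
  split=> [|q]; first by case: Fn => _ [].
  by rewrite in_setU1 negb_or => /andP[_ qI]; apply: Fn.2.2.
rewrite mulmxA; set w := v *m DPn n x in IHJ IHj *; split.
  move=> i iJ; rewrite mxE big1 // => k _.
  have [kJ|kJ] := boolP (k \in (j |: I)%SET); last by rewrite IHJ ?mul0r.
  by rewrite (jacobian_face0 Pg H2 fJ kJ iJ) mulr0.
rewrite [in RHS]big_ord_recr /= mulrA -IHj mxE (bigD1 j) //=.
rewrite [X in _ + X]big1 ?addr0 // => k kj.
have [kI|kI] := boolP (k \in I).
  by rewrite (jacobian_face0 Pg H2 Fn.2 kI jNI) mulr0.
by rewrite IHJ ?mul0r // in_setU1 negb_or kj.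
Qed.

(** A vector of exponent [l] in [V_(I + j)] but outside [V_I] has a nonzero coordinate [j]. Its
    growth bounds the product of the [(j, j)] entries of [DP] from above, hence that of their
    reciprocals from below. *)
Lemma external_product_ge x s E E' l e : F x ->
  oseledets_splitting (DPn^~ x) (DQn^~ x) (coord_space I) s E ->
  oseledets_splitting (DPn^~ x) (DQn^~ x) (coord_space (j |: I)%SET)
    (l :: s) E' ->
  0 < e -> \forall n \near \oo,
    expR (- (n%:R * (l + e))) <= \prod_(k < n) invD (iter k P x) j j.
Proof.
move=> Fx spl spl' e0; have Sx := Fx.1.
have [v [vJ vI [vexp _]]] := external_vector (fun n v => @DPn_inj x n v Sx)
  (fun n v => @DQn_inj x n v Sx) spl spl'.
have vj : v 0 j != 0.
  apply/eqP => vj; apply: vI => i iI; have [->//|ij] := eqVneq i j.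
  by apply: vJ; rewrite in_setU1 negb_or ij.
have := growth_leM (`|v 0 j|^-1) (fun n => normr_ge0 _)
  (exact_growth_le (fun n => normr_ge0 _) vexp).
move=> /(_ _ e0); apply: filterS => n.
have [_ vn] := DPn_external n Fx vJ.
set q := \prod_(k < n) invD _ _ _.
have q0 : 0 <= q.
  apply: prodr_ge0 => k _; apply: (S_invD_ge0 Pg H3 S_cs); exact: S_iter.
have q1 : \prod_(k < n) jacobian P (iter k P x) j j * q = 1.
  rewrite -big_split /= big1 // => k _.
  exact: (jacobian_invD_diag Pg H2 (F_iter H2 S_cs I_gt0 k Fx).2 jNI).
have := coord_le_norm (v *m DPn n x) j; rewrite vn normrM.
set p := \prod_(k < n) _ in q1 *; set w := `|v *m _| => h1 h2.
have qn0 : q != 0.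
  by apply/eqP => q00; move/eqP: q1; rewrite q00 mulr0 eq_sym oner_eq0.
have qgt0 : 0 < q by rewrite lt_neqAle eq_sym qn0.
have pE : q^-1 = p by rewrite -[LHS]mul1r -q1 mulfK.
rewrite expRN -[leRHS]invrK lef_pV2 ?posrE ?invr_gt0 ?expR_gt0 // pE.
apply: le_trans h2.
rewrite ler_pdivlMl ?normr_gt0 //; apply: le_trans h1.
by apply: ler_wpM2l => //; exact: ler_norm.
Qed.

End Exponents.

(** Logarithmic form of the final contradiction at time [m + 2], each visit being worth [16 e]. At
    least [m / 2] visits gain [8 m e = 8 (m + 2) e - 16 e], the two error terms cost [2 (m + 2) e],
    and the remaining [6 (m + 2) e] exceeds [D + 16 e]. *)
Lemma growth_comparison {R : realFieldType} (m v e l lp D : R) :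
  D + 16%:R * e < (m + 2) * (6%:R * e) -> (m + 2) * l <= (m + 2) * lp ->
  m * e <= v * 2 * e ->
  D + (m + 2) * (- lp + e) < - ((m + 2) * (l + e)) + v * (16%:R * e).
Proof. lra. Qed.

(** * Measure estimates along orbits and the comparison of exponents *)

Section FaceMeasure.
Context {R : realType} {N : nat}.
Local Notation V := 'rV[R]_N.
Context (P g : V -> V) (U : set V) (Pg : C2_inverse P g U).
Context (H2 : faces_invariant P) (H3 : inverse_derivative_positive P).
Context (S : set V) (S_cs : carrying_simplex P S).
Context (S_convex : convex_set (cone_over S : set (convex_lmodType V))).
Context (I : {set 'I_N}) (j : 'I_N) (jNI : j \notin I).
Context (I_gt0 : (0 < #|I|)%N).
Context (mu : probability (borel_rV R N) R).
Context (mu_inv : invariant_measure P mu) (muI : mu (S `&` face_int I) = 1%E).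
Implicit Types (x v : V) (A : set V).

Local Notation invD := (invD P).
Local Notation F := (S `&` face I).
Local Notation Q := ('pinv_(fun=> 0) S P).
Local Notation DPn := (cocycle P (jacobian P)).
Local Notation DQn := (cocycle Q (fun y => invmx (jacobian P (Q y)))).

Let gP x : U x -> g (P x) = x. Proof. by case: Pg => _ _ _ _ h; exact: h. Qed.
Let SU : S `<=` U. Proof. exact: (S_dom Pg S_cs). Qed.
Let Fit n x : F x -> F (iter n P x). Proof. exact: F_iter. Qed.
Let FU x : F x -> U x. Proof. by move=> [/SU]. Qed.

Lemma S_closed : closed S.
Proof.
apply: compact_closed; last exact: (S_compact S_cs).
exact: norm_hausdorff.
Qed.

Lemma F_closed : closed F.
Proof. by apply: closedI; [exact: S_closed|exact: face_closed]. Qed.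

Lemma F_compact : compact F.
Proof.
by apply: compact_closedI; [exact: (S_compact S_cs)|exact: face_closed].
Qed.

Lemma iter_continuous n x : F x -> {for x, continuous (iter n P)}.
Proof.
elim: n => [|n IH] Fx; first exact: cvg_id.
apply: (@continuous_comp _ _ _ (iter n P) P); first exact: IH.
exact: (P_continuous Pg (FU (Fit n Fx))).
Qed.

Lemma invD_iter_continuous n k i x : F x ->
  {for x, continuous (fun z => invD (iter n P z) k i)}.
Proof.
move=> Fx; apply: (@continuous_comp _ _ _ (iter n P) (fun y => invD y k i)).
  exact: iter_continuous.
exact: (invD_continuous Pg (FU (Fit n Fx))).
Qed.

Lemma invDn_continuous n k i x : F x ->
  {for x, continuous (fun z => invDn P n z k i)}.
Proof.
move=> Fx; elim: n k i => [|n IH] k i; first exact: cst_continuous.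
have -> : (fun z => invDn P n.+1 z k i) =
  (fun z => \sum_q invD (iter n P z) k q * invDn P n z q i).
  by apply/funext => z /=; rewrite mxE.
apply: continuous_sumr => q _; apply: continuousM; last exact: IH.
exact: invD_iter_continuous.
Qed.

Lemma pullback_closed n A : closed A -> closed (F `&` iter n P @^-1` A).
Proof.
move=> Acl; apply: closed_setI_preimage => //; first exact: F_closed.
by move=> x; exact: iter_continuous.
Qed.

(** Invariance of [mu] concerns preimages in the orthant; these lie in [F] because [F] is backward
    invariant. Closedness provides measurability at each stage. *)
Lemma mu_pullback n A : closed A -> A `<=` F ->
  mu (F `&` iter n P @^-1` A) = mu A.
Proof.
elim: n A => [|n IH] A Acl AF.
  by congr (mu _); apply/seteqP; split => [x []//|x Ax]; split => //; exact: AF.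
have mA : measurable (F `&` iter n P @^-1` A : set (borel_rV R N)).
  by apply: closed_measurable_rV; exact: pullback_closed.
rewrite -(IH A Acl AF) -(mu_inv mA).
congr (mu _); apply/seteqP; split => x.
  move=> [Fx]; rewrite /preimage /= -iterS iterSr => Ax; split.
    exact: (S_orthant S_cs) Fx.1.
  by split=> //; exact: (Fit 1 Fx).
move=> [x0 [FPx Ax]]; split.
  exact: (F_preimage Pg H2 S_cs I_gt0 x0 FPx).
by rewrite /preimage /= -iterS iterSr.
Qed.

Lemma F_ae : {ae mu, forall x : V, (S `&` face_int I) x}.
Proof.
apply: ae_of_probability1 => //; apply: face_int_measurable; exact: S_closed.
Qed.

(** The l1 norm dominates the norm of row vectors and is visibly continuous in the entries. *)
Definition backward_small n (c : R) : set V := F `&`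
  [set x | \sum_i `|(onesI I *m invDn P n x) 0 i| <= c].

Lemma backward_small_closed n c : closed (backward_small n c).
Proof.
apply: (@closed_setI_preimage _ _ F
  (fun x => \sum_i `|(onesI I *m invDn P n x) 0 i|) [set r : R | r <= c]).
- exact: F_closed.
- exact: closed_le.
move=> x Fx; apply: continuous_sumr => i _.
apply: (@continuous_comp _ _ _ (fun x => (onesI I *m invDn P n x) 0 i)
  (fun r : R => `|r|)); last exact: norm_continuous.
have -> : (fun z => (onesI I *m invDn P n z) 0 i) =
  (fun z => \sum_q onesI I 0 q * invDn P n z q i).
  by apply/funext => z /=; rewrite mxE.
apply: continuous_sumr => q _; apply: continuousM; last exact: invDn_continuous.
exact: cst_continuous.
Qed.

Definition forward_large n (c : R) : set V := F `&`
  [set x | c <= \prod_(k < n) invD (iter k P x) j j].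

Lemma forward_large_closed n c : closed (forward_large n c).
Proof.
apply: (@closed_setI_preimage _ _ F
  (fun x => \prod_(k < n) invD (iter k P x) j j) [set r : R | c <= r]).
- exact: F_closed.
- exact: closed_ge.
by move=> x Fx; apply: continuous_prodr => k _; exact: invD_iter_continuous.
Qed.

Lemma good_set_closed kappa : closed (good_set P S I j kappa).
Proof.
have -> : good_set P S I j kappa = \bigcap_(k in [set k | k \in I])
    (F `&` (fun x => \sum_(i in I) invD (P x) j i * invD x i k) @^-1`
      [set r : R | kappa <= r]).
  have [k0 k0I] := card_gt0P I_gt0.
  apply/seteqP; split => [x [Fx gx] k kI|x h]; first by split => //; exact: gx.
  split=> [|k kI]; first by have [] := h _ k0I.
  by have [] := h _ kI.
apply: closed_bigI => k _; apply: closed_setI_preimage.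
- exact: F_closed.
- exact: closed_ge.
move=> x Fx; apply: continuous_sumr => i _; apply: continuousM.
  exact: (@invD_iter_continuous 1).
exact: (@invD_iter_continuous 0).
Qed.

(** For [x] in the relative interior of the face, the second half of (H3') at [P x], applied to
    [e_j], gives some [i] in [I] reached from [j], and the first half at [x] spreads this to every
    [k] in [I]. *)
Lemma good_set_ae : {ae mu, forall x : V, \forall n \near \oo,
  good_set P S I j n.+1%:R^-1 x}.
Proof.
have [Z [mZ Z0 sZ]] := F_ae; exists Z; split => //; apply: subset_trans sZ.
apply: subsetC => x [Sx xI]; have [fx _] := xI.
have Fx : F x by [].
have FPx : F (P x) := Fit 1 Fx.
have PxI : face_int I (P x).
  have [+ _] := H2 I_gt0 (A := face_int I) (or_intror (or_introl erefl)).
  by apply; exists x.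
have pos k : k \in I -> 0 < \sum_(i in I) invD (P x) j i * invD x i k.
  move=> kI; have [_ /(_ (delta_mx 0 j))] := H3 I_gt0 PxI.
  case.
  - split=> [i|i]; first by rewrite mxE ler0n.
    rewrite finset.in_setC negbK mxE eqxx /= => iI.
    by case: eqVneq iI => // ->; rewrite (negPf jNI).
  - apply/eqP => /matrixP /(_ 0 j); rewrite !mxE !eqxx => /eqP.
    by rewrite oner_eq0.
  move=> i iI; rewrite -invD_invmx -rowE mxE => pi.
  rewrite (bigD1 i) //= ltr_wpDr //.
    apply: sumr_ge0 => q _.
    apply: mulr_ge0; apply: (S_invD_ge0 Pg H3 S_cs) => //.
    exact: FPx.1.
  rewrite mulr_gt0 // invD_invmx; have [+ _] := H3 I_gt0 xI; exact.
have : \forall n \near \oo, forall k, k \in I ->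
    n.+1%:R^-1 <= \sum_(i in I) invD (P x) j i * invD x i k.
  apply: filter_forall => k; have [kI|_] := boolP (k \in I); last by near=> n.
  near=> n => _; apply/ltW; near: n.
  exact: (near_infty_natSinv_lt (PosNum (pos k kI))).
by apply: filterS => n h; split.
Unshelve. all: end_near. Qed.

Lemma ae_combine3 (A B C D : set V) : (forall x, A x -> B x -> C x -> D x) ->
  {ae mu, forall x : V, A x} -> {ae mu, forall x : V, B x} ->
  {ae mu, forall x : V, C x} -> {ae mu, forall x : V, D x}.
Proof.
move=> ABCD hA hB hC.
have hAB := @filterI _ _ (ae_filter_ringOfSetsType mu) _ _ hA hB.
have hABC := @filterI _ _ (ae_filter_ringOfSetsType mu) _ _ hAB hC.
apply: (@filterS _ _ (ae_filter_ringOfSetsType mu) _ _ _ hABC).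
by move=> x [[Ax Bx] Cx]; exact: ABCD.
Qed.

Lemma forward_large_ae s l e :
  lyapunov_exponents P S mu I s ->
  lyapunov_exponents P S mu (j |: I)%SET (l :: s) -> 0 < e ->
  {ae mu, forall x : V, \forall n \near \oo,
     forward_large n (expR (- (n%:R * (l + e)))) x}.
Proof.
move=> /lyapunov_splitting hs /lyapunov_splitting hls e0.
apply: (ae_combine3 _ F_ae hs hls) => x [Sx [fx _]] [E spl] [E' spl'].
have Fx : F x by [].
have := external_product_ge Pg H2 H3 S_cs jNI I_gt0 Fx spl spl' e0.
by apply: filterS => n h; split.
Qed.

Lemma F_preimage_iter n x : F x -> exists2 y, F y & iter n P y = x.
Proof.
elim: n x => [|n IH] x Fx; first by exists x.
have [y Sy yx] := S_preimage_in S_cs Fx.1.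
have [|z Fz zy] := IH y.
  apply: (F_preimage Pg H2 S_cs I_gt0 (S_orthant S_cs Sy)).
  by rewrite yx.
by exists z => //=; rewrite zy.
Qed.

(** The exponents control the backward cocycle from a fixed end point [z], so the estimate holds at
    the point [x] with [P^n x = z]; hence the image under [iter n P]. *)
Lemma backward_small_ae s m e : lyapunov_exponents P S mu I s ->
  (forall l, l \in s -> m <= l) -> 0 < e ->
  {ae mu, forall z : V, \forall n \near \oo,
     (iter n P @` backward_small n (expR (n%:R * (- m + e)))) z}.
Proof.
move=> /lyapunov_splitting hs sm e0.
apply: (ae_combine3 _ F_ae F_ae hs) => z [Sz [fz _]] _ [E spl].
have Fz : F z by [].
have := backward_growth_le spl sm (onesI_face (I := I)).
move=> /(growth_leM N%:R (fun n => normr_ge0 _)) /(_ _ e0).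
apply: filterS => n hn.
have [x Fx xz] := F_preimage_iter n Fz; exists x => //; split => //.
apply: le_trans hn; rewrite -xz (DQn_iter Pg S_cs n Fx.1).
apply: le_trans (_ : \sum_(i < N) `|onesI I *m invDn P n x| <= _).
  by apply: ler_sum => i _; exact: coord_le_norm.
by rewrite sumr_const card_ord mulr_natl.
Qed.

Lemma iter_inj_on n x y : F x -> F y -> iter n P x = iter n P y -> x = y.
Proof.
elim: n => // n IH Fx Fy /=.
move=> /(congr1 g); rewrite !gP; [exact: IH|exact/FU/Fit|exact/FU/Fit].
Qed.

Lemma backward_small_image_closed n c : closed (iter n P @` backward_small n c).
Proof.
apply: compact_closed; first exact: norm_hausdorff.
apply: continuous_compact; last first.
  apply: subclosed_compact F_compact _; first exact: backward_small_closed.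
  by move=> x [].
apply/subspace_continuousP => x [Fx _]; apply: cvg_within_filter.
exact: iter_continuous.
Qed.

(** By injectivity of [P^n] on [F], the set is the pullback of its own image. *)
Lemma mu_backward_small n c :
  mu (iter n P @` backward_small n c) = mu (backward_small n c).
Proof.
have sub : backward_small n c `<=` F by move=> x [].
rewrite -(@mu_pullback n); first last.
- by move=> _ [x [Fx _] <-]; exact: Fit.
- exact: backward_small_image_closed.
congr (mu _); apply/seteqP; split => x.
  by move=> [Fx [y yb /iter_inj_on <-]] //; exact: sub.
by move=> xb; split; [exact: sub|exists x].
Qed.

Lemma principal_lt_external s s' lp l :
  lyapunov_exponents P S mu I s' -> (forall l', l' \in s' -> lp <= l') ->
  lyapunov_exponents P S mu I s ->
  lyapunov_exponents P S mu (j |: I)%SET (l :: s) -> lp < l.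
Proof.
move=> hs' lps hs hls; rewrite ltNge; apply/negP => llp.
(* Three events, each failing with probability at most 1/16, fail to hold jointly with probability
   at most 3/16, below the threshold 1/3 of the Markov argument. *)
have e16 : 0 < 16%:R^-1 :> R by rewrite invr_gt0.
have mgood kappa : measurable (good_set P S I j kappa : set (borel_rV R N)).
  by apply: closed_measurable_rV; exact: good_set_closed.
have [n0 _ /(_ n0 (leqnn _)) good_le] :=
  eventually_in_measure (fun n => mgood n.+1%:R^-1) good_set_ae e16.
have kappa0 : 0 < n0.+1%:R^-1 :> R by rewrite invr_gt0.
set kappa := n0.+1%:R^-1 in good_le kappa0.
have [gain [D [gain0 D0 bound]]] :=
  external_product_bound Pg H2 H3 S_cs S_convex jNI I_gt0 kappa0.
(* Chosen so that each visit contributes the factor [expR (16 * e)]. *)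
pose e := ln (1 + gain) / 16%:R.
have e0 : 0 < e by rewrite divr_gt0 // ln_gt0 // ltrDl.
have mfwd n c : measurable (forward_large n c : set (borel_rV R N)).
  by apply: closed_measurable_rV; exact: forward_large_closed.
have fwd := eventually_in_measure (fun n => mfwd n _)
  (forward_large_ae hs hls e0) e16.
have mbwd n c :
    measurable (iter n P @` backward_small n c : set (borel_rV R N)).
  by apply: closed_measurable_rV; exact: backward_small_image_closed.
have bwd := eventually_in_measure (fun n => mbwd n _)
  (backward_small_ae hs' lps e0) e16.
have [n [n2 nbig fn bn]] : exists n, [/\ (2 <= n)%N,
    (ln D + 16%:R * e) / (6%:R * e) < n%:R,
    (mu (~` forward_large n (expR (- (n%:R * (l + e))))) <= (16%:R^-1)%:E)%E &
    (mu (~` (iter n P @` backward_small n (expR (n%:R * (- lp + e)))))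
      <= (16%:R^-1)%:E)%E].
  near \oo => n; exists n; split; near: n.
  - exact: nbhs_infty_ge.
  - exact: nbhs_infty_gtr.
  - exact: fwd.
  - exact: bwd.
case: n n2 nbig fn bn => [|[|m]] // _; set n := m.+2.
set c1 := expR (- _); set c2 := expR (_ * _) => nbig fn bn.
have mbwd' : measurable (backward_small n c2 : set (borel_rV R N)).
  by apply: closed_measurable_rV; exact: backward_small_closed.
(* The estimate known for almost every end point is moved to the starting point by invariance. *)
have bn' : (mu (~` backward_small n c2) <= (16%:R^-1)%:E)%E.
  by rewrite probability_setC // -mu_backward_small -probability_setC.
pose H := good_set P S I j kappa `&` forward_large n c1 `&` backward_small n c2.
have mH : measurable (H : set (borel_rV R N)).
  by apply: measurableI => //; exact: measurableI.
have HC : (mu (~` H) <= (3%:R / 16%:R)%:E)%E.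
  rewrite /H setCI [X in X `|` _]setCI.
  have h1 := measurableC (mgood kappa).
  have h2 := measurableC (mfwd n c1).
  apply: le_trans (measureU2 mu (measurableU _ _ h1 h2) (measurableC mbwd')) _.
  have -> : ((3%:R / 16%:R)%:E =
      (16%:R^-1)%:E + (16%:R^-1)%:E + (16%:R^-1)%:E :> \bar R)%E.
    by rewrite -!EFinD; congr EFin; field.
  apply: leeD => //; apply: le_trans (measureU2 mu h1 h2) _.
  exact: leeD.
pose B k : set V := ~` (F `&` iter k.+1 P @^-1` good_set P S I j kappa).
have mpull k : measurable (F `&` iter k.+1 P @^-1` good_set P S I j kappa
    : set (borel_rV R N)).
  apply: closed_measurable_rV; apply: pullback_closed.
  exact: good_set_closed.
have mB k : measurable (B k : set (borel_rV R N)) by exact: measurableC.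
have BC k : (mu (B k) <= (3%:R / 16%:R)%:E)%E.
  rewrite probability_setC // mu_pullback; first last.
  - by move=> x [].
  - exact: good_set_closed.
  rewrite -probability_setC //; apply: le_trans good_le _.
  by rewrite lee_fin; lra.
have [|x [[gx fx] bx] few] := exists_rarely_in m mH mB HC BC; first by lra.
have Fx := gx.1.
set A := good_set P S I j kappa in gx bound.
(* As the orbit of [x] stays in [F], lying in [B k] means exactly missing the good set at time
   [k + 1]; misses occur at most half of the time. *)
have half : (m <= visits P A x m * 2)%N.
  have sum_m : (visits P A x m + \sum_(k < m) (x \in B k) = m)%N.
    rewrite /visits -big_split /= -[RHS]card_ord -sum1_card.
    apply: eq_bigr => k _.
    have -> : (x \in B k) = (iter k.+1 P x \notin A).
      apply/idP/idP => [/set_mem nB|/negP nA].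
        by apply/negP => /set_mem kA; apply: nB.
      by apply/mem_set => -[_ kA]; apply: nA; exact: mem_set.
    by case: (_ \in _).
  move: few sum_m; rewrite -big_distrl /=.
  by move: (\sum_(k < m) _)%N (visits P A x m) => b v; clear; lia.
have := bound x m gx.
have : `|onesI I *m invDn P m.+2 x| <= c2.
  by apply: le_trans (norm_le_sum _) bx.2.
have := fx.2; rewrite /=.
set p := \prod_(k < _) _; set w := `|_|; set v := visits P A x m in half *.
move=> pc1 wc2 pw.
have gE : 1 + gain = expR (16%:R * e).
  have -> : 16%:R * e = ln (1 + gain) by rewrite /e; field.
  by rewrite lnK // posrE addr_gt0.
have : c1 * expR (v%:R * (16%:R * e)) <= expR (ln D) * c2.
  rewrite lnK ?posrE // expRM_natl -gE.
  apply: le_trans (_ : p * (1 + gain) ^+ v <= _).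
    by apply: ler_wpM2r => //; apply: exprn_ge0; rewrite addr_ge0 // ltW.
  by apply: le_trans pw _; apply: ler_wpM2l => //; exact: ltW.
rewrite -!expRD ler_expR; apply/negP; rewrite -ltNge.
have e6 : 0 < 6%:R * e by apply: mulr_gt0.
move: nbig; rewrite (ltr_pdivrMr _ _ e6) => nbig.
have nl : n%:R * l <= n%:R * lp by apply: ler_wpM2l.
have half' : m%:R * e <= v%:R * 2 * e.
  by apply: ler_wpM2r; [exact: ltW|rewrite -natrM ler_nat].
have nE : n%:R = m%:R + 2 :> R by rewrite /n -addn2 natrD.
move: nbig nl half'; rewrite nE; exact: growth_comparison.
Unshelve. all: end_near. Qed.

End FaceMeasure.

(** The face of the empty set is the origin, whose radial projection 0 is not in the simplex. *)
Lemma carrier_nonempty {R : realType} {N : nat} (P : 'rV[R]_N -> 'rV[R]_N)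
    (S : set 'rV[R]_N) (I : {set 'I_N}) :
  carrying_simplex P S -> (S `&` face_int I) !=set0 -> (0 < #|I|)%N.
Proof.
move=> [_ [[Srad _ _] _ _] _ _ _] [x [Sx [[_ xI] _]]].
rewrite lt0n; apply/negP => /eqP /cards0_eq I0.
have x0 : x = 0 by apply/rowP => i; rewrite mxE xI // I0 inE.
have [_ /=] := Srad _ Sx; rewrite x0 /radial scaler0.
by under eq_bigr do rewrite mxE; rewrite big1_eq => /esym/eqP; rewrite oner_eq0.
Qed.

Unset Implicit Arguments.

Theorem theorem4p1 (R : realType) (N : nat) (N_ge2 : (2 <= N)%N)
  (P : 'rV[R]_N -> 'rV[R]_N)
  (H1 : C2_diffeo_on_orthant P)
  (H2 : faces_invariant P)
  (H3' : inverse_derivative_positive P)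
  (H4' : axial_fixed_points P)
  (H5 : periodic_eigenvalue_lt1 P)
  (H6 : ratio_monotone P)
  (S : set 'rV[R]_N) (S_cs : carrying_simplex P S)
  (S_convex : convex_set (cone_over S : set (convex_lmodType 'rV[R]_N)))
  (mu : probability (borel_rV R N) R) (mu_ergodic : ergodic_measure P mu)
  (mu_bd : mu (S `&` orthant_bd) = 1%E)
  (I : {set 'I_N}) (mu_I : mu (S `&` face_int I) = 1%E)
  (lp : R) (lp_principal : principal_exponent P S mu I lp)
  (j : 'I_N) (jNI : j \notin I)
  (l : R) (l_external : external_exponent P S mu I j l) :
  lp < l.
Proof.
have [U orthU [oU oPU PC2 [g gC2 gP]]] := H1.
have Pg : C2_inverse P g U by split.
have [s' hs' [_ lps]] := lp_principal.
have [s hs hls] := l_external.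
have I_gt0 : (0 < #|I|)%N.
  apply: (carrier_nonempty S_cs); apply/set0P/eqP => SI0.
  by move/eqP: mu_I; rewrite SI0 measure0 eqe eq_sym oner_eq0.
exact: (principal_lt_external Pg H2 H3' S_cs S_convex jNI I_gt0
  mu_ergodic.1 mu_I hs' lps hs hls).
Qed.
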